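(* Let $0<\gamma<1$. Suppose $f\in C^{1}(\alpha,\beta)$ for some interval $(\alpha,\beta)$ and $f'$ is locally Lipschitz on $(\alpha,\beta)$. Let $u_0\in(\alpha,\beta)$. Then the solution $u$ of $D_c^{\gamma}u=f(u)$ with $u(0)=u_0$ is monotone on its interval of existence $(0,T_b)$. If $f(u_0)\neq 0$, the monotonicity is strict.
   Context: Fix $\gamma\in(0,1)$. A function $u\in L^1_{loc}(0,T)$ has right limit $u(0+)=u_0$ at $t=0$ if $\lim_{t\to0+}\frac1t\int_0^t|u(s)-u_0|\,ds=0$. For such $u$, the (generalized) Caputo derivative is the distribution on $(-\infty,T)$ supported in $[0,T)$ given by $D_c^{\gamma}u=g_{-\gamma}*\big((u-u(0+))\theta(t)\big)$, where $\theta$ is the Heaviside function and $g_{-\gamma}=\frac{1}{\Gamma(1-\gamma)}D\big(\theta(t)t^{-\gamma}\big)$ with $D$ the distributional derivative. A strong solution of $D_c^\gamma u=f(u)$, $u(0)=u_0$, is such a $u$ with $u(0+)=u_0$, $D_c^{\gamma}u\in L^1(0,T)$, satisfying the equation almost everywhere. It is known that for continuous $u$ the problem is equivalent to the Volterra equation $u(t)=u_0+\frac{1}{\Gamma(\gamma)}\int_0^t(t-s)^{\gamma-1}f(u(s))\,ds$. If $f$ is locally Lipschitz on $(\alpha,\beta)$ and $u_0\in(\alpha,\beta)$, there is a unique continuous strong solution (with values in $(\alpha,\beta)$) on a maximal interval $[0,T_b)$, $T_b\in(0,\infty]$, and if $T_b<\infty$ then $\liminf_{t\to T_b^-}u(t)=\alpha$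 or $\limsup_{t\to T_b^-}u(t)=\beta$. ''The solution'' and $T_b$ refer to this. *)

(* Defs.v *)
From HB Require Import structures.
From mathcomp Require Import all_boot all_order all_algebra.
From mathcomp Require Import all_classical all_reals all_analysis.

Set Implicit Arguments.
Unset Strict Implicit.
Unset Printing Implicit Defensive.

Import Order.TTheory GRing.Theory Num.Theory.
Import numFieldNormedType.Exports.

Local Open Scope classical_set_scope.
Local Open Scope ring_scope.

Definition open_itv {R : realType} (a b : \bar R) : set R :=
  [set x : R | (a < x%:E < b)%E].

Definition C1_on {R : realType} (A : set R) (f : R -> R) :=
  (forall x, A x -> derivable f x 1) /\
  (forall x, A x -> {for x, continuous (derive1 f)}).

Definition locally_lipschitz_on {R : realType} (A : set R) (g : R -> R) :=
  forall x, A x -> exists2 U : set R, nbhs x U & [lipschitz g z | z in U `&` A].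

Definition Gamma {R : realType} (a : R) : R :=
  \int[lebesgue_measure]_(x in `]0, +oo[) (x `^ (a - 1) * expR (- x)).

Definition heaviside {R : realType} (t : R) : R := if 0 <= t then 1 else 0.

(* A distribution is represented by its action on functions R -> R; equality of
   distributions on (-oo, T) is equality of the values on [test_function T]. *)

Definition test_function {R : realType} (T : R) (phi : R -> R) :=
  [/\ forall (n : nat) (x : R), derivable (derive1n n phi) x 1,
      compact (closure [set x | phi x != 0]) &
      closure [set x | phi x != 0] `<=` `]-oo, T[].

Definition distr {R : realType} := (R -> R) -> R.

Definition distr_of_fun {R : realType} (g : R -> R) : @distr R :=
  fun phi => \int[lebesgue_measure]_x (g x * phi x).

Definition distr_deriv {R : realType} (G : @distr R) : @distr R :=
  fun phi => - G (derive1 phi).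

(* <G * H, phi> = <G(s), <H(t), phi(s + t)>>.  The inner function of s need not
   have compact support.  No cut-off is inserted: the only G used below is
   g_{-gamma}, whose action involves only the values on s > 0, and there, for phi
   supported in (-oo, T) and H supported in [0, +oo), only the restriction of H
   to (-oo, T) matters. *)
Definition distr_conv {R : realType} (G H : @distr R) : @distr R :=
  fun phi => G (fun s => H (fun t => phi (s + t))).

Definition g_neg {R : realType} (gamma : R) : @distr R :=
  fun phi => (Gamma (1 - gamma))^-1 *
    distr_deriv (distr_of_fun (fun t => heaviside t * t `^ (- gamma))) phi.

(* u(0+) = u0.  The integral is extended-real valued, so the condition also says
   that u is integrable near 0. *)
Definition right_limit {R : realType} (u : R -> R) (u0 : R) :=
  ((t^-1)%:E * \int[lebesgue_measure]_(s in `]0%R, t[) `|(u s - u0)%:E|)%E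
    @[t --> 0^'+] --> 0%E.

(* The Caputo derivative of a function with u(0+) = u0; as a distribution on
   (-oo, T) it depends only on u on [0, T). *)
Definition caputo {R : realType} (gamma : R) (u : R -> R) (u0 : R) : @distr R :=
  distr_conv (g_neg gamma)
    (distr_of_fun (fun t => (u t - u0) * heaviside t)).

Definition strong_solution {R : realType} (gamma : R) (f : R -> R) (u0 T : R)
    (u : R -> R) :=
  [/\ locally_integrable `]0, T[ u,
      right_limit u u0 &
      exists h : R -> R,
        [/\ lebesgue_measure.-integrable `]0, T[ (EFin \o h),
            forall phi, test_function T phi ->
              caputo gamma u u0 phi =
              \int[lebesgue_measure]_(t in `]0, T[) (h t * phi t) &
            {ae lebesgue_measure, forall t, 0 < t < T -> h t = f (u t)}]].

Definition time_itv {R : realType} (T : \bar R) : set R :=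
  [set t : R | (0 <= t%:E < T)%E].

(* Continuous strong solution on [0, T) with values in (alpha, beta).  The
   integrability of the Caputo derivative is required on (0, S) for S < T only:
   it may fail on (0, T) when u blows up at T or when T = +oo. *)
Definition continuous_solution {R : realType} (gamma : R) (alpha beta : \bar R)
    (f : R -> R) (u0 : R) (T : \bar R) (u : R -> R) :=
  [/\ {within time_itv T, continuous u},
      forall t, time_itv T t -> open_itv alpha beta (u t) &
      forall S : R, 0 < S -> (S%:E < T)%E -> strong_solution gamma f u0 S u].

Definition maximal_solution {R : realType} (gamma : R) (alpha beta : \bar R)
    (f : R -> R) (u0 : R) (Tb : \bar R) (u : R -> R) :=
  [/\ (0 < Tb)%E,
      continuous_solution gamma alpha beta f u0 Tb u &
      forall (T : \bar R) (v : R -> R), (Tb < T)%E ->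
        (forall t, time_itv Tb t -> v t = u t) ->
        ~ continuous_solution gamma alpha beta f u0 T v].

Definition monotone_on {R : realType} (A : set R) (u : R -> R) :=
  {in A &, {homo u : x y / x <= y}} \/ {in A &, {homo u : x y / x <= y >-> y <= x}}.

Definition strictly_monotone_on {R : realType} (A : set R) (u : R -> R) :=
  {in A &, {homo u : x y / x < y}} \/ {in A &, {homo u : x y / x < y >-> y < x}}.

(* Main.v *)
Require Import Defs.
From HB Require Import structures.
From mathcomp Require Import all_boot all_order all_algebra.
From mathcomp Require Import all_classical all_reals all_analysis.
From mathcomp Require Import measurable_realfun.
From mathcomp Require Import ring lra.

Import Order.TTheory GRing.Theory Num.Theory.
Import numFieldNormedType.Exports.

Local Open Scope classical_set_scope.
Local Open Scope ring_scope.

(** Fix S < Tb and put y = u - u0 and F = f o u on [0, S], both extended by 0;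
    write g(t) = t^(gamma - 1) and k(t) = t^(-gamma) for t > 0.

    The equation first becomes the Volterra equation y = C (g * F) with C > 0.
    Tested against a bump chi, it reads as an identity between integrals of
    k, y, F and chi.  The translates of chi to the left are admissible as well;
    integrating the identity over all of them with weight g produces g * k, which
    is constant (a beta integral), and what remains is that chi is orthogonal to
    y - C (g * F).  Since this function is continuous and chi is arbitrary, it
    vanishes ([weak_bump_orthogonal], [strong_solution_volterra]).

    On [0, S] the values of u stay in a compact part of (alpha, beta), where f is
    Lipschitz with some constant L.  If f(u0) = 0, then |F| <= L |y|, and iterating
    the Volterra equation over short time steps gives y = 0 ([zero_of_volterra]).

    Let f(u0) > 0.  For h > 0 the increments Z(x) = y(x) - y(x - h) and
    D(x) = F(x) - F(x - h) satisfy Z = C (g * D), and |D| <= L |Z| to the right of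
    h.  For small h, F is positive near 0, so Z > 0 on (0, h]; suppose that x0 is
    the first zero of Z.  The equation has memory, so D >= -L Z near x0 cannot be
    integrated as a differential inequality.  The memory is removed by a Poisson
    formula ([conv_split]): for T < x0,

      (g * D)(x0) = int_(t < T) P(t) (g * D)(t) dt + int_(T < t < x0) g(x0 - t) D(t) dt

    with an explicit density P >= 0 ([poisson]).  In the first integral g * D = Z / C
    is nonnegative and bounded below on a fixed interval, while P is there at least
    a constant times (x0 - T)^gamma; so that integral is at least c (x0 - T)^gamma
    with c > 0.  The second one is at least -c' (x0 - T)^gamma times the supremum of
    Z over [T, x0), which tends to 0 as T tends to x0.  Hence Z(x0) > 0, a
    contradiction ([conv_pos_at]).  Thus u(x + h) > u(x) for all small h, and u is
    strictly increasing ([strictly_increasing_of_pos]).  The case f(u0) < 0 is the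
    same with -y and -F.

    The Poisson formula rests on the Moebius substitution t = [mobius_map] w, which
    turns the integral defining it into a beta integral ([mobius_integral]). *)

(** * Translations and reflections of the Lebesgue integral *)

Section invariance.
Context {R : realType}.
Local Notation mu := (@lebesgue_measure R).

Lemma integrable_measurable (a : R -> R) : mu.-integrable setT (EFin \o a) ->
  measurable_fun setT a.
Proof. by move=> /integrableP[/measurable_EFinP]. Qed.

Lemma lebesgue_measure_shift (c : R) (A : set R) : measurable A ->
  pushforward mu ((fun x => x + c) : _ -> measurableTypeR R) A = mu A.
Proof.
move=> mA; have mc : measurable_fun setT ((fun x => x + c) : measurableTypeR R -> measurableTypeR R).
  exact: measurable_funD.
apply/esym/lebesgue_measure_unique => //= _ [[a b]] _ <-.
rewrite /pushforward.
have -> : (fun x => x + c) @^-1` `]a, b]%classic = `](a - c), (b - c)]%classic.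
  by apply/seteqP; split => x /=; rewrite !in_itv/= ltrBlDr lerBrDr.
rewrite !lebesgue_measure_itv/= !lte_fin ltrD2r.
by congr (if _ then _ else _); rewrite -!EFinB; congr EFin; ring.
Qed.

(** For nonnegative functions this is the change of variables for a pushforward
    measure; a function of variable sign is split into its positive and negative
    parts. *)
Lemma integral_comp_preserving (phi : R -> R) (f : R -> \bar R) :
  measurable_fun setT phi ->
  (forall A, measurable A -> pushforward mu (phi : _ -> measurableTypeR R) A = mu A) ->
  measurable_fun setT f ->
  (\int[mu]_x f (phi x) = \int[mu]_x f x)%E.
Proof.
move=> mphi inv mf.
have pos (h : R -> \bar R) : measurable_fun setT h -> (forall x, (0 <= h x)%E) ->
    (\int[mu]_x h (phi x) = \int[mu]_x h x)%E.
  move=> mh h0; transitivity (\int[pushforward mu (phi : _ -> measurableTypeR R)]_x h x)%E.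
    rewrite (@ge0_integral_pushforward _ _ (measurableTypeR R) (measurableTypeR R)) //=.
  by apply: eq_measure_integral => A mA _; exact: inv.
rewrite -[LHS]/(\int[mu]_x (f \o phi) x)%E integralE [RHS]integralE.
congr (_ - _)%E.
- under eq_integral do rewrite funepos_comp/=.
  by apply: pos => //; exact: measurable_funepos.
- under eq_integral do rewrite funeneg_comp/=.
  by apply: pos => //; exact: measurable_funeneg.
Qed.

Lemma Rintegral_shift (c : R) (f : R -> R) : measurable_fun setT f ->
  \int[mu]_x f (x + c) = \int[mu]_x f x.
Proof.
move=> mf; congr fine.
apply: (integral_comp_preserving (fun x => x + c) (EFin \o f)).
- exact: measurable_funD.
- exact: lebesgue_measure_shift.
- exact/measurable_EFinP.
Qed.

Lemma Rintegral_opp (f : R -> R) : measurable_fun setT f ->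
  \int[mu]_x f (- x) = \int[mu]_x f x.
Proof.
move=> mf; congr fine.
apply: (integral_comp_preserving -%R (EFin \o f)).
- exact: measurable_funN.
- exact: lebesgue_measureN.
- exact/measurable_EFinP.
Qed.

Lemma Rintegral_reflect (c : R) (f : R -> R) : measurable_fun setT f ->
  \int[mu]_x f (c - x) = \int[mu]_x f x.
Proof.
move=> mf; rewrite -(Rintegral_shift c f mf) -(Rintegral_opp (fun x => f (x + c))).
  by apply: eq_Rintegral => x _; rewrite addrC.
by apply: measurableT_comp => //; exact: measurable_funD.
Qed.

Lemma measurable_comp_sub (c : R) (f : R -> R) :
  measurable_fun setT f -> measurable_fun setT (fun x : R => f (c - x)).
Proof. by move=> mf; apply: (measurableT_comp mf); exact: measurable_funB. Qed.

Lemma integrable_reflect (c : R) (f : R -> R) : mu.-integrable setT (EFin \o f) ->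
  mu.-integrable setT (EFin \o (fun x => f (c - x))).
Proof.
move=> fi; have mf := integrable_measurable f fi; move: fi => /integrableP[_ fi].
have mfc : measurable_fun setT (fun x : R => f (c - x)).
  by apply: (measurableT_comp mf); exact: measurable_funB.
apply/integrableP; split; first exact/measurable_EFinP.
move: fi; apply: le_lt_trans; rewrite le_eqVlt; apply/orP; left; apply/eqP.
rewrite -(integral_comp_preserving (fun x => x + c) (fun x => `|(f x)%:E|)%E).
- rewrite -[RHS](integral_comp_preserving -%R (fun x => `|(f (x + c))%:E|)%E).
  + by apply: eq_integral => x _ /=; rewrite addrC.
  + exact: measurable_funN.
  + exact: lebesgue_measureN.
  + apply/measurable_EFinP; apply: measurableT_comp => //.
    by apply: (measurableT_comp mf); exact: measurable_funD.
- exact: measurable_funD.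
- exact: lebesgue_measure_shift.
- by apply/measurable_EFinP; exact: measurableT_comp.
Qed.

End invariance.

(** * Fubini's theorem for real-valued integrals *)

Section fubini.
Context {R : realType}.
Local Notation mu := (@lebesgue_measure R).

Lemma Rintegral_eq0 (f : R -> R) : (forall x, f x = 0) ->
  \int[mu]_x f x = 0.
Proof. by move=> f0; rewrite /Rintegral integral0_eq // => x _; rewrite f0. Qed.

Lemma ae_lebesgue_imply (P Q : R -> Prop) : (forall x, P x -> Q x) ->
  {ae mu, forall x, P x} -> {ae mu, forall x, Q x}.
Proof.
move=> PQ; apply: filterS; last exact: PQ.
exact: (ae_filter_ringOfSetsType (lebesgue_measure : {measure set (measurableTypeR R) -> \bar R})).
Qed.

Lemma Rintegral_fine_ae (f : R -> \bar R) : measurable_fun setT f ->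
  {ae mu, forall x, f x \is a fin_num} ->
  \int[mu]_x fine (f x) = fine (\int[mu]_x f x).
Proof.
move=> mf fin; congr fine; apply: ae_eq_integral => //.
  by apply/measurable_EFinP; exact: measurableT_comp.
by apply: (ae_lebesgue_imply _ _ _ fin) => x fx _ /=; rewrite fineK.
Qed.

(** The inner integrals can be infinite on a null set, where their real-valued
    versions are 0; the outer integrals do not see the difference. *)
Lemma Rintegral_swap (H : R * R -> R) :
  (mu \x mu)%E.-integrable setT (EFin \o H) ->
  \int[mu]_x \int[mu]_y H (x, y) = \int[mu]_y \int[mu]_x H (x, y).
Proof.
move=> iH.
rewrite /Rintegral.
rewrite -[LHS]/(\int[mu]_x fine ((\int[mu]_y (H (x, y))%:E)%E)).
rewrite -[RHS]/(\int[mu]_x fine ((\int[mu]_y (H (y, x))%:E)%E)).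
rewrite Rintegral_fine_ae.
- rewrite Rintegral_fine_ae.
  + by congr fine; exact: (Fubini iH).
  + exact: (measurable_fubini_G iH).
  + apply: (ae_lebesgue_imply _ _ _ (ae_integrable2 iH)) => y iy.
    exact: integrable_fin_num.
- exact: (measurable_fubini_F iH).
- apply: (ae_lebesgue_imply _ _ _ (ae_integrable1 iH)) => y iy.
  exact: integrable_fin_num.
Qed.

(** Tonelli applies with the bound M |a x| |b y|, whose iterated integral is finite. *)
Lemma integrable_prod (a b : R -> R) (h : R * R -> R) (M : R) :
  mu.-integrable setT (EFin \o a) -> mu.-integrable setT (EFin \o b) ->
  measurable_fun setT h -> (forall z, `|h z| <= M) ->
  (mu \x mu)%E.-integrable setT (EFin \o (fun z => a z.1 * (b z.2 * h z))).
Proof.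
move=> ia ib mh hM.
have ma := integrable_measurable a ia.
have mb := integrable_measurable b ib.
have M0 : 0 <= M by apply: le_trans (hM (0, 0)).
have mH : measurable_fun setT (fun z : R * R => a z.1 * (b z.2 * h z)).
  apply: measurable_funM; first exact: measurableT_comp.
  by apply: measurable_funM => //; exact: measurableT_comp.
apply/integrable12ltyP; first exact/measurable_EFinP.
rewrite /=.
have := integrableP _ _ _ ia => -[_ ia'].
have := integrableP _ _ _ ib => -[_ ib'].
pose B := (\int[mu]_y `|(b y)%:E|)%E.
have Bfin : B \is a fin_num by rewrite ge0_fin_numE // integral_ge0.
apply: (@le_lt_trans _ _ (\int[mu]_x ((fine B * M)%:E * `|(a x)%:E|))%E).
  apply: ge0_le_integral => //.
  - by move=> x _; apply: integral_ge0.
  - apply: (measurable_fun_fubini_tonelli_F (m2 := mu) (abse \o (EFin \o (fun z : R * R => a z.1 * (b z.2 * h z))))) => //=.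
    by apply/measurable_EFinP; apply: measurableT_comp.
  - apply: emeasurable_funM => //.
    by apply/measurable_EFinP; apply: measurableT_comp.
  - move=> x _ /=.
    apply: (@le_trans _ _ (\int[mu]_y ((M * `|a x|)%:E * `|(b y)%:E|))%E).
      apply: ge0_le_integral => //.
      + apply/measurable_EFinP; apply: measurableT_comp => //.
        apply: measurable_funM => //.
        apply: measurable_funM => //.
        exact: measurableT_comp.
      + by apply/measurable_EFinP; apply: measurable_funM => //; apply: measurableT_comp.
      + move=> y _ ; rewrite lee_fin !normrM /=.
        rewrite [leRHS](_ : _ = `|a x| * (`|b y| * M)); last by ring.
        by rewrite ler_wpM2l // ler_wpM2l.
    rewrite ge0_integralZl//=; last 2 first.
      + by apply/measurable_EFinP; apply: measurableT_comp.
      + by rewrite lee_fin mulr_ge0.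
    rewrite -/B -[B in leLHS]fineK // -!EFinM lee_fin.
    by rewrite [leLHS](_ : _ = fine B * M * `|a x|) //; ring.
rewrite ge0_integralZl//=; last 2 first.
- by apply/measurable_EFinP; apply: measurableT_comp.
- by rewrite lee_fin mulr_ge0 // fine_ge0 // integral_ge0.
by apply: lte_mul_pinfty => //; rewrite lee_fin mulr_ge0 // fine_ge0 // integral_ge0.
Qed.
End fubini.

(** * Convolutions on the line *)

Section convolution.
Context {R : realType}.
Local Notation mu := (@lebesgue_measure R).

Definition conv (a b : R -> R) (x : R) : R := \int[mu]_t (a t * b (x - t)).

Lemma measurable_comp_prod (b : R -> R) (phi : R * R -> R) :
  measurable_fun setT b -> measurable_fun setT phi ->
  measurable_fun setT (fun z : R * R => b (phi z)).
Proof. by move=> mb mphi; apply: measurableT_comp. Qed.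

Lemma measurable_sub_prod : measurable_fun setT (fun z : R * R => z.2 - z.1).
Proof. by apply: measurable_funB. Qed.

Lemma measurable_add_prod : measurable_fun setT (fun z : R * R => z.2 + z.1).
Proof. by apply: measurable_funD. Qed.

Lemma integrable_bounded_mul (a h : R -> R) (M : R) :
  mu.-integrable setT (EFin \o a) -> measurable_fun setT h -> (forall x, `|h x| <= M) ->
  mu.-integrable setT (EFin \o (fun x => a x * h x)).
Proof.
move=> ia mh hM.
have -> : EFin \o (fun x => a x * h x) = ((EFin \o a) \* (EFin \o h))%E by [].
apply: integrableMl => //.
exists M; split; first exact: num_real.
by move=> N MN x _; exact: le_trans (hM x) (ltW MN).
Qed.

Lemma Rintegral_swap_bounded (a b : R -> R) (h : R * R -> R) (M : R) :
  mu.-integrable setT (EFin \o a) -> mu.-integrable setT (EFin \o b) ->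
  measurable_fun setT h -> (forall z, `|h z| <= M) ->
  \int[mu]_x (a x * \int[mu]_y (b y * h (x, y))) =
  \int[mu]_y (b y * \int[mu]_x (a x * h (x, y))).
Proof.
move=> ia ib mh hM.
have mhl (x : R) : measurable_fun setT (fun y => h (x, y)) by exact: measurableT_comp.
have mhr (y : R) : measurable_fun setT (fun x => h (x, y)) by exact: measurableT_comp.
have iH := integrable_prod a b h M ia ib mh hM.
transitivity (\int[mu]_x \int[mu]_y (a x * (b y * h (x, y)))).
  apply: eq_Rintegral => x _; rewrite RintegralZl //.
  by apply: (integrable_bounded_mul _ _ M) => // y; exact: hM.
rewrite (Rintegral_swap (fun z => a z.1 * (b z.2 * h z))) //=.
apply: eq_Rintegral => y _; rewrite -RintegralZl //.
  by apply: eq_Rintegral => x _; ring.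
by apply: (integrable_bounded_mul _ _ M) => // x; exact: hM.
Qed.

Lemma Rintegral_not_integrable (f : R -> R) : measurable_fun setT f ->
  ~ mu.-integrable setT (EFin \o f) -> \int[mu]_x f x = 0.
Proof.
move=> mf nif; rewrite /Rintegral.
have [fin|] := boolP ((\int[mu]_x (f x)%:E)%E \is a fin_num); last first.
  by rewrite fin_numE negb_and !negbK => /orP[] /eqP ->.
exfalso; apply: nif; apply/integrableP; split; first exact/measurable_EFinP.
by rewrite (integral_fin_num_abs mu measurableT mf).
Qed.

(** The real-valued integral of a measurable function that is not integrable is 0, so
    homogeneity extends to such functions. *)
Lemma RintegralZl_measurable (c : R) (f : R -> R) : measurable_fun setT f ->
  \int[mu]_x (c * f x) = c * \int[mu]_x f x.
Proof.
move=> mf; have [->|c0] := eqVneq c 0.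
  by rewrite mul0r; under eq_Rintegral do rewrite mul0r; rewrite Rintegral_cst ?mul0r.
have [fi|nfi] := pselect (mu.-integrable setT (EFin \o f)); first by rewrite RintegralZl.
rewrite (Rintegral_not_integrable f) // mulr0 Rintegral_not_integrable //.
  exact: measurable_funM.
move=> icf; apply: nfi.
have -> : EFin \o f = (fun x => (c^-1)%:E * (c * f x)%:E)%E.
  by apply/funext => x /=; rewrite -EFinM mulKf.
exact: integrableZl.
Qed.

(** The convolution of a and b, integrated against L: Fubini after the substitution
    x = s + t. *)
Lemma conv_swap (a b L : R -> R) (M : R) :
  mu.-integrable setT (EFin \o a) -> mu.-integrable setT (EFin \o b) ->
  measurable_fun setT L -> (forall x, `|L x| <= M) ->
  \int[mu]_t (a t * \int[mu]_s (b s * L (s + t))) = \int[mu]_x (L x * conv a b x).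
Proof.
move=> ia ib mL LM.
have ma := integrable_measurable a ia; have mb := integrable_measurable b ib.
have M0 : 0 <= M by apply: le_trans (LM 0).
pose H (z : R * R) := a z.1 * (b (z.2 - z.1) * L z.2).
have mH : measurable_fun setT H.
  apply: measurable_funM; first exact: measurableT_comp.
  apply: measurable_funM; last exact: measurableT_comp.
  by apply: (measurable_comp_prod b) => //; exact: measurable_sub_prod.
pose H1 (z : R * R) := a z.1 * (b z.2 * L (z.2 + z.1)).
have iH1 : (mu \x mu)%E.-integrable setT (EFin \o H1).
  apply: (integrable_prod a b (fun z => L (z.2 + z.1)) M) => //.
  by apply: (measurable_comp_prod L) => //; exact: measurable_add_prod.
have iH : (mu \x mu)%E.-integrable setT (EFin \o H).
  apply/integrable12ltyP; first exact/measurable_EFinP.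
  have /integrable12ltyP := iH1 => /(_ (measurable_int _ iH1)).
  apply: le_lt_trans; rewrite le_eqVlt; apply/orP; left; apply/eqP.
  apply: eq_integral => t _ /=.
  rewrite -(integral_comp_preserving (fun x => x + t) (fun y => `|(H (t, y))%:E|)%E) //=.
  - by apply: eq_integral => s _; rewrite /H /H1 /= addrK.
  - exact: measurable_funD.
  - exact: lebesgue_measure_shift.
  - apply/measurable_EFinP; apply: measurableT_comp => //.
    exact: measurableT_comp.
transitivity (\int[mu]_t \int[mu]_x H (t, x)).
  apply: eq_Rintegral => t _; rewrite -RintegralZl //.
    rewrite -[RHS](Rintegral_shift t).
      by apply: eq_Rintegral => s _; rewrite /H /= addrK.
    by apply: (measurableT_comp mH); exact: measurable_pair1.
  apply: (integrable_bounded_mul _ _ M) => //.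
  by apply: measurableT_comp => //; exact: measurable_funD.
rewrite Rintegral_swap //; apply: eq_Rintegral => x _.
rewrite /conv /H /=.
rewrite -RintegralZl_measurable.
  by apply: eq_Rintegral => t _; ring.
apply: measurable_funM => //.
by apply: measurableT_comp => //; exact: measurable_funB.
Qed.
End convolution.

Section conv_bounded.
Context {R : realType}.
Local Notation mu := (@lebesgue_measure R).
Variables (a D : R -> R) (M : R).
Hypotheses (ia : mu.-integrable setT (EFin \o a)) (mD : measurable_fun setT D)
  (DM : forall x, `|D x| <= M).

Lemma integrable_conv_integrand (x : R) :
  mu.-integrable setT (EFin \o (fun t => a t * D (x - t))).
Proof.
apply: (integrable_bounded_mul _ _ M) => //.
by apply: (measurableT_comp mD); exact: measurable_funB.
Qed.

Lemma conv_bounded (x : R) : `|conv a D x| <= (\int[mu]_t `|a t|) * M.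
Proof.
have M0 : 0 <= M := le_trans (normr_ge0 _) (DM 0).
apply: le_trans (le_normr_Rintegral measurableT (integrable_conv_integrand x)) _.
rewrite -RintegralZr //; last exact: integrable_norm.
apply: le_Rintegral => //.
- exact/integrable_norm/integrable_conv_integrand.
- have := integrableZl measurableT M (integrable_norm ia).
  by apply: eq_integrable => // t _ /=; rewrite -EFinM mulrC.
- by move=> t _; rewrite normrM ler_wpM2l.
Qed.

(** Adding M |a t| makes the integrand nonnegative, and Tonelli then gives the
    measurability of the integral in its parameter. *)
Lemma measurable_conv : measurable_fun setT (conv a D).
Proof.
have ma := integrable_measurable a ia.
have M0 : 0 <= M := le_trans (normr_ge0 _) (DM 0).
pose H (z : R * R) := a z.2 * D (z.1 - z.2) + M * `|a z.2|.
have mH : measurable_fun setT H.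
  apply: measurable_funD.
    apply: measurable_funM; first by apply: (measurableT_comp ma).
    by apply: (measurableT_comp mD); exact: measurable_funB.
  apply: measurable_funM => //; apply: measurableT_comp => //.
  exact: (measurableT_comp ma).
have H0 z : 0 <= H z.
  rewrite /H -lerBlDr sub0r.
  have /ler_normlP [] : `|a z.2 * D (z.1 - z.2)| <= M * `|a z.2|.
    by rewrite normrM mulrC ler_wpM2r.
  by move=> h _; rewrite lerNl.
have iN : mu.-integrable setT (EFin \o (fun t => M * `|a t|)).
  have := integrableZl measurableT M (integrable_norm ia).
  by apply: eq_integrable => // t _ /=; rewrite -EFinM.
have -> : conv a D = (fun x => fine (\int[mu]_t (H (x, t))%:E)%E - \int[mu]_t (M * `|a t|)).
  apply/funext => x; rewrite -/(\int[mu]_t H (x, t)) /H /= RintegralD ?addrK //.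
  exact: integrable_conv_integrand.
apply: measurable_funB => //; apply: measurableT_comp => //.
apply: (measurable_fun_fubini_tonelli_F (m2 := mu) (EFin \o H)) => //.
exact/measurable_EFinP.
Qed.
End conv_bounded.

(** * Change of variables on open intervals *)

Section substitution.
Context {R : realType}.
Local Notation mu := (@lebesgue_measure R).

Lemma small_fraction (c e : R) : 0 < e -> exists n : nat, c / (n%:R + 3) < e.
Proof.
move=> e0; have [c0|c0] := leP c 0.
  exists 0%N; apply: le_lt_trans e0; rewrite pmulr_lle0 // invr_gt0.
have ce : 0 <= c / e by rewrite divr_ge0 ?ltW.
exists (Num.bound (c / e)); have n3 : 0 < ((Num.bound (c / e))%:R + 3 : R) by rewrite ltr_wpDl.
rewrite ltr_pdivrMr // mulrC -ltr_pdivrMr //.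
by apply: lt_le_trans (archi_boundP ce) _; rewrite lerDl.
Qed.

Lemma itvoo_bigcup (a b : R) : a < b ->
  `]a, b[%classic =
  \bigcup_(n in @setT nat) `[a + (b - a) / (n%:R + 3), b - (b - a) / (n%:R + 3)]%classic.
Proof.
move=> ab; have ba : 0 < b - a by rewrite subr_gt0.
apply/seteqP; split => x /=.
  rewrite in_itv/= => /andP[ax xb].
  have [n hn] := small_fraction (b - a) (Num.min (x - a) (b - x)) ltac:(by rewrite lt_min !subr_gt0 ax xb).
  exists n => //=; rewrite in_itv/=.
  move: hn; rewrite lt_min => /andP[h1 h2].
  set d := (b - a) / _ in h1 h2 *.
  by apply/andP; split; lra.
move=> [n _] /=; rewrite !in_itv/= => /andP[h1 h2].
have d0 : 0 < (b - a) / (n%:R + 3) by rewrite divr_gt0 // ltr_wpDl.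
set d := (b - a) / _ in h1 h2 d0.
by apply/andP; split; lra.
Qed.

(** The summand 3 keeps both margins at most a third of the length, so that the
    shrunk interval is never degenerate. *)
Lemma itv_shrink (a b : R) (n : nat) : a < b ->
  [/\ a < a + (b - a) / (n%:R + 3), a + (b - a) / (n%:R + 3) < b - (b - a) / (n%:R + 3) &
      b - (b - a) / (n%:R + 3) < b].
Proof.
move=> ab; have n0 : 0 <= (n%:R : R) by [].
have n3 : 0 < (n%:R + 3 : R) by rewrite ltr_wpDl.
have d0 : 0 < (b - a) / (n%:R + 3) by rewrite divr_gt0 // subr_gt0.
have d1 : (b - a) / (n%:R + 3) <= (b - a) / 3.
  by rewrite ler_pM2l ?subr_gt0 // lef_pV2 ?posrE // lerDr.
set d := (b - a) / (n%:R + 3) in d0 d1 *.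
by split; lra.
Qed.

Lemma shrink_nd (a b : R) (m n : nat) : a < b -> (m <= n)%N ->
  (b - a) / (n%:R + 3) <= (b - a) / (m%:R + 3).
Proof.
move=> ab mn; rewrite ler_pM2l ?subr_gt0 // lef_pV2 ?posrE ?ltr_wpDl //.
by rewrite lerD2r ler_nat.
Qed.

(** G may be unbounded at both ends of the interval, as in beta integrals: the
    formula on closed subintervals passes to the limit by monotone convergence. *)
Lemma ge0_integration_by_substitution_oo (F G : R -> R) (a b : R) : a < b ->
  {in `[a, b] &, {homo F : x y / x < y}} ->
  {in `[a, b], forall x, derivable F x 1} ->
  {in `[a, b], continuous (derive1 F)} ->
  {in `]F a, F b[, forall x, 0 <= G x} ->
  {in `]F a, F b[, continuous G} ->
  (\int[mu]_(x in `]F a, F b[) (G x)%:E =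
   \int[mu]_(x in `]a, b[) (G (F x) * derive1 F x)%:E)%E.
Proof.
move=> ab incF dF cF' G0 cG.
have ain : a \in `[a, b] by rewrite in_itv/= lexx ltW.
have bin : b \in `[a, b] by rewrite in_itv/= lexx ltW.
have cF : {in `[a, b], continuous F}.
  by move=> x xab; apply/differentiable_continuous/derivable1_diffP/dF.
have wF : {within `[a, b], continuous F}.
  by apply: continuous_in_subspaceT => x /set_mem xab; apply: cF.
pose d n : R := (b - a) / (n%:R + 3).
have sub n : `[a + d n, b - d n]%classic `<=` `]a, b[%classic.
  by rewrite itvoo_bigcup // => x xn; exists n.
have subc x : x \in `]a, b[ -> x \in `[a, b].
  by apply: subset_itv_oo_cc.
have Fin x : x \in `]a, b[ -> F x \in `]F a, F b[.
  move=> xab; have := subc _ xab; move: xab; rewrite !in_itv/= => /andP[ax xb] xab.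
  by rewrite !incF // in_itv.
have mono : {in `[a, b] &, {homo F : x y / x <= y}}.
  move=> x y xab yab; rewrite le_eqVlt => /orP[/eqP->//|xy].
  by apply/ltW/incF.
have cov : `]F a, F b[%classic = \bigcup_(n in @setT nat) `[F (a + d n), F (b - d n)]%classic.
  apply/seteqP; split => y /=.
    rewrite in_itv/= => /andP[y1 y2].
    have [|x xab Fx] := @IVT R F a b y (ltW ab) wF.
      by rewrite (le_trans (_ : _ <= y)) ?ge_min ?le_max ?(ltW y1) ?(ltW y2) ?orbT.
    have xo : `]a, b[%classic x.
      rewrite /= in_itv/= !lt_neqAle; move: xab; rewrite in_itv/= => /andP[-> ->].
      rewrite !andbT; apply/andP; split; apply/eqP => e; move: y1 y2; rewrite -Fx -?e ltxx //.
    have := xo; rewrite itvoo_bigcup // => -[n _ xn]; exists n => //.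
    have [h1 h2 h3] := itv_shrink a b n ab.
    move: xn; rewrite /= !in_itv/= -Fx => /andP[x1 x2].
    by rewrite !mono // ?in_itv/=; rewrite /d; apply/andP; split; lra.
  move=> [n _] /=; rewrite !in_itv/= => /andP[y1 y2].
  have [h1 h2 h3] := itv_shrink a b n ab.
  apply/andP; split.
    by apply: lt_le_trans y1; apply: incF => //; rewrite in_itv/= /d; apply/andP; split; lra.
  by apply: le_lt_trans y2 _; apply: incF => //; rewrite in_itv/= /d; apply/andP; split; lra.
have covin n x : x \in `[F (a + d n), F (b - d n)] -> x \in `]F a, F b[.
  move=> xn; have : `]F a, F b[%classic x by rewrite cov; exists n.
  exact.
have mG : measurable_fun `]F a, F b[ G.
  by apply: open_continuous_measurable_fun => // x /set_mem; exact: cG.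
have F'0 x : x \in `]a, b[ -> 0 <= derive1 F x.
  move=> xab; apply: (incr_derive1_ge0_itv _ incF xab).
  by move=> z /set_mem zab; exact/dF/subc.
have mI : measurable_fun `]a, b[ (fun x => G (F x) * derive1 F x).
  apply: open_continuous_measurable_fun => // x /set_mem xab.
  apply: cvgM; last exact/cF'/subc.
  apply: continuous_comp; first exact/cF/subc.
  exact/cG/Fin.
have dnd m n : (m <= n)%N -> d n <= d m by move=> mn; exact: shrink_nd.
have nd1 : nondecreasing_seq (fun n => `[a + d n, b - d n]%classic).
  move=> m n /dnd mn; apply/subsetPset => x /=; rewrite !in_itv/= => /andP[x1 x2].
  by apply/andP; split; lra.
have nd2 : nondecreasing_seq (fun n => `[F (a + d n), F (b - d n)]%classic).
  move=> m n /dnd mn; apply/subsetPset => x /=; rewrite !in_itv/= => /andP[x1 x2].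
  have [h1 h2 h3] := itv_shrink a b m ab.
  have [h4 h5 h6] := itv_shrink a b n ab.
  rewrite -/(d m) -/(d n) in h1 h2 h3 h4 h5 h6.
  apply/andP; split.
    apply: le_trans x1; apply: mono; [| |by lra]; rewrite in_itv/=; apply/andP; split; lra.
  apply: le_trans x2 _; apply: mono; [| |by lra]; rewrite in_itv/=; apply/andP; split; lra.
have lim1 := @ge0_nondecreasing_set_cvg_integral _ (measurableTypeR R) _ _ (fun x => (G (F x) * derive1 F x)%:E) mu nd1.
have lim2 := @ge0_nondecreasing_set_cvg_integral _ (measurableTypeR R) _ _ (fun x => (G x)%:E) mu nd2.
rewrite [in RHS]itvoo_bigcup // cov.
apply: (cvg_unique _ (lim2 _ _ _)) => //.
- move=> n; apply/measurable_EFinP; apply: measurable_funS mG => //.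
  by rewrite cov => x xn; exists n.
- by move=> n x /covin xn; rewrite lee_fin G0.
rewrite (_ : (fun n => _) =
    (fun n => \int[mu]_(x in `[(a + d n)%R, (b - d n)%R]) (G (F x) * derive1 F x)%:E)%E).
  apply: lim1 => //.
  - by move=> n; apply/measurable_EFinP; apply: measurable_funS mI => //; exact: sub.
  - by move=> n x /sub xn; rewrite lee_fin mulr_ge0 // ?F'0 // G0 // Fin.
apply/funext => n.
have [h1 h2 h3] := itv_shrink a b n ab; rewrite -/(d n) in h1 h2 h3.
have ns x : x \in `[a + d n, b - d n] -> x \in `[a, b].
  by rewrite !in_itv/= => /andP[x1 x2]; apply/andP; split; lra.
have nl : a + d n \in `[a, b] by apply: ns; rewrite in_itv/= lexx ltW.
have nr : b - d n \in `[a, b] by apply: ns; rewrite in_itv/= lexx ltW.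
apply: integration_by_substitution_increasing.
- exact: ltW.
- by move=> x y xn yn xy; apply: incF => //; exact: ns.
- by move=> x xn; apply: cF'; apply/ns/subset_itv_oo_cc.
- by apply: (cvgP (derive1 F (a + d n))); apply: cvg_at_right_filter; exact: cF'.
- by apply: (cvgP (derive1 F (b - d n))); apply: cvg_at_left_filter; exact: cF'.
- split.
  + by move=> x xn; apply: dF; apply/ns/subset_itv_oo_cc.
  + by apply: cvg_at_right_filter; exact: cF.
  + by apply: cvg_at_left_filter; exact: cF.
- apply: continuous_in_subspaceT => x /set_mem /covin xn.
  exact: cG.
Qed.
End substitution.

(** * Power kernels and beta integrals *)

Section power_kernel.
Context {R : realType}.
Local Notation mu := (@lebesgue_measure R).

(** The truncation at S makes the power integrable on the line.  At points x < S it
    does not change the convolution with a function that vanishes on negative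
    numbers. *)
Definition ker (a S x : R) : R := if 0 < x < S then x `^ a else 0.

Lemma ker_ge0 (a S x : R) : 0 <= ker a S x.
Proof. by rewrite /ker; case: ifP => // _; exact: powR_ge0. Qed.

Lemma ker_le0 (a S x : R) : x <= 0 -> ker a S x = 0.
Proof. by move=> x0; rewrite /ker ifF //; apply/negP => /andP[]; rewrite ltNge x0. Qed.

Lemma ker_in (a S x : R) : 0 < x -> x < S -> ker a S x = x `^ a.
Proof. by move=> x0 xS; rewrite /ker x0 xS. Qed.

Lemma ker_restrict (a S : R) : ker a S = (fun x => x `^ a) \_ `]0, S[.
Proof.
apply/funext => x; rewrite /ker patchE; case: ifPn => h.
  by rewrite mem_set //= in_itv.
by rewrite memNset //= in_itv/=; exact/negP.
Qed.

Lemma measurable_ker (a S : R) : measurable_fun setT (ker a S).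
Proof.
rewrite ker_restrict; apply/(measurable_restrictT _ _).1 => //.
by apply: measurable_funTS; exact: measurable_powR.
Qed.

Lemma cvg_fraction (c : R) : c / (n%:R + 3) @[n --> \oo] --> 0.
Proof.
rewrite -[X in _ --> X](mulr0 c); apply: cvgMl_tmp.
have := @cvg_harmonic R; rewrite -(cvg_shiftn 2).
apply: cvg_trans; apply: near_eq_cvg; apply: nearW => n /=.
by rewrite -natr1 natrD; congr (_ ^-1); rewrite -addrA; congr (_ + _); ring.
Qed.

Lemma continuous_powR (a x : R) : 0 < x -> {for x, continuous (fun z => z `^ a)}.
Proof.
move=> x0; apply/differentiable_continuous/derivable1_diffP.
by apply: derivable_powR; rewrite in_itv/= x0.
Qed.

(** The singularity at 0 is approached through the closed intervals of
    [itvoo_bigcup], on which the fundamental theorem of calculus applies. *)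
Lemma integral_power (r x : R) : 0 < r -> 0 < x ->
  (\int[mu]_(t in `]0%R, x[) (t `^ (r - 1))%:E = (x `^ r / r)%:E)%E.
Proof.
move=> r0 x0.
pose d n : R := (x - 0) / (n%:R + 3).
have nd1 : nondecreasing_seq (fun n => `[0 + d n, x - d n]%classic).
  move=> m n mn; have := shrink_nd 0 x m n x0 mn; rewrite -!/(d _) => {}mn.
  apply/subsetPset => z /=; rewrite !in_itv/= => /andP[x1 x2].
  by apply/andP; split; lra.
have lim1 := @ge0_nondecreasing_set_cvg_integral _ (measurableTypeR R) R _
  (fun t => (t `^ (r - 1))%:E) mu nd1.
rewrite itvoo_bigcup //.
apply: (cvg_unique _ (lim1 _ _ _)) => //.
- by move=> n; apply/measurable_EFinP; apply: measurable_funTS; exact: measurable_powR.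
- by move=> n z _; rewrite lee_fin powR_ge0.
have -> : (fun n => \int[mu]_(t in `[(0 + d n)%R, (x - d n)%R]) (t `^ (r - 1))%:E)%E =
    EFin \o (fun n => ((x - d n) `^ r - (0 + d n) `^ r) / r).
  apply/funext => n; have [h1 h2 h3] := itv_shrink 0 x n x0.
  rewrite -/(d n) in h1 h2 h3.
  have pos z : z \in `[0 + d n, x - d n] -> 0 < z.
    by rewrite in_itv/= => /andP[z1 z2]; lra.
  rewrite (continuous_FTC2 (F := fun z => z `^ r / r)) //=.
  - by rewrite -EFinB; congr EFin; rewrite mulrBl.
  - apply: continuous_in_subspaceT => z /set_mem /pos; exact: continuous_powR.
  - split.
    + move=> z /subset_itv_oo_cc /pos z0; apply: derivableM => //.
      by apply: derivable_powR; rewrite in_itv/= z0.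
    + apply: cvg_at_right_filter; apply: cvgMr_tmp; apply: continuous_powR; lra.
    + apply: cvg_at_left_filter; apply: cvgMr_tmp; apply: continuous_powR; lra.
  - move=> z /subset_itv_oo_cc /pos z0.
    rewrite derive1E deriveMr; last by apply: derivable_powR; rewrite in_itv/= z0.
    rewrite -derive1E powR_derive1 ?in_itv/= ?z0 //.
    by rewrite mulKf // gt_eqF.
apply/cvg_EFin; first exact: nearW.
have dcv : d n @[n --> \oo] --> 0 by apply: cvg_fraction.
apply: cvgMr_tmp; rewrite -[X in _ --> X](subr0 (x `^ r)); apply: cvgB.
  apply: (@cvg_comp _ _ _ (fun n => x - d n) (fun z => z `^ r) _ (nbhs x)); last exact: continuous_powR.
  suff : x - d n @[n --> \oo] --> x by [].
  by rewrite -[X in _ --> X](subr0 x); apply: cvgB => //; exact: cvg_cst.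
have /cvg_at_rightP := powR_cvg0 r0; apply; split.
  by move=> n; have [] := itv_shrink 0 x n x0.
by rewrite -[X in _ --> X](addr0 0); apply: cvgD => //; exact: cvg_cst.
Qed.

Lemma integral_ker (r x : R) : 0 < r -> 0 < x ->
  (\int[mu]_t (ker (r - 1) x t)%:E = (x `^ r / r)%:E)%E.
Proof.
move=> r0 x0; rewrite -integral_power // [RHS]integral_mkcond.
by apply: eq_integral => t _; rewrite ker_restrict restrict_EFin.
Qed.

Lemma Rintegral_ker (r x : R) : 0 < r -> 0 < x -> \int[mu]_t ker (r - 1) x t = x `^ r / r.
Proof. by move=> r0 x0; rewrite /Rintegral integral_ker. Qed.

Lemma integrable_ker (a S : R) : -1 < a -> mu.-integrable setT (EFin \o ker a S).
Proof.
move=> a1; have r0 : 0 < a + 1 by lra.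
have [S0|S0] := leP S 0.
  rewrite (_ : EFin \o _ = cst 0%E); first exact: integrable0.
  apply/funext => x /=; rewrite /ker ifF //; apply/negP => /andP[x0 xS].
  by have := lt_le_trans (lt_trans x0 xS) S0; rewrite ltxx.
apply/integrableP; split; first by apply/measurable_EFinP; exact: measurable_ker.
under eq_integral do rewrite /= ger0_norm ?ker_ge0 //.
rewrite (_ : a = (a + 1) - 1); last by rewrite addrK.
by rewrite integral_ker // ltry.
Qed.

(** In the usual notation this is B(p + 1, q + 1). *)
Definition beta (p q : R) : R := conv (ker p 1) (ker q 1) 1.

Lemma kerS (a S T x : R) : x < S -> S <= T -> ker a S x = ker a T x.
Proof.
by move=> xS ST; rewrite /ker xS andbT (lt_le_trans xS ST) andbT.
Qed.

Lemma conv_ker_restrict (p q S x : R) : x <= S ->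
  (fun t => ker p S t * ker q S (x - t)) = (fun t => t `^ p * (x - t) `^ q) \_ `]0, x[.
Proof.
move=> xS; apply/funext => t; rewrite /ker patchE; case: ifPn => h1; last first.
  by rewrite mul0r memNset //= in_itv/= => /andP[t0 tx]; move: h1; rewrite t0 (lt_le_trans tx xS).
case: ifPn => h2.
  by rewrite mem_set //= in_itv/=; move: h1 h2 => /andP[-> _] /andP[]; rewrite subr_gt0.
rewrite mulr0 memNset //= in_itv/= => /andP[t0 tx]; move: h2.
by move/negP; apply; apply/andP; split; lra.
Qed.

Lemma powR_combine (x a b c : R) : 0 < x -> a + b = c -> x `^ a * x `^ b = x `^ c.
Proof.
by move=> x0 <-; rewrite powRD // (gt_eqF x0) implybT.
Qed.

Lemma betaE (p q : R) : beta p q = \int[mu]_(t in `]0, 1[) (t `^ p * (1 - t) `^ q).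
Proof. by rewrite /beta /conv conv_ker_restrict // -Rintegral_mkcond. Qed.

Lemma derive1_scale (x : R) : derive1 (fun w : R => x * w) = cst x.
Proof.
apply/funext => w; rewrite derive1E deriveMl //.
by rewrite derive_id mulr1.
Qed.

Lemma continuous_powR_comp (h : R -> R) (a x : R) :
  {for x, continuous h} -> 0 < h x -> {for x, continuous (fun z => h z `^ a)}.
Proof.
move=> ch hx; apply: (@continuous_comp _ _ _ h (fun z => z `^ a)) => //.
exact: continuous_powR.
Qed.

(** The substitution t = x w produces the power x^(p + q + 1), which is 1: this is
    why the convolution of the two kernels is constant. *)
Lemma conv_ker (p q S x : R) : p + q = -1 -> 0 < x -> x <= S ->
  conv (ker p S) (ker q S) x = beta p q.
Proof.
move=> pq x0 xS; rewrite /conv conv_ker_restrict // -Rintegral_mkcond betaE.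
apply: (f_equal fine).
have -> : `]0, x[%classic = `](x * 0), (x * 1)[%classic by rewrite mulr0 mulr1.
rewrite (ge0_integration_by_substitution_oo (fun w => x * w)
  (fun t => t `^ p * (x - t) `^ q)) //.
- apply: eq_integral => w /set_mem /=; rewrite in_itv/= => /andP[w0 w1].
  have w1' : 0 < 1 - w by rewrite subr_gt0.
  congr EFin; rewrite derive1_scale /cst.
  rewrite (_ : x - x * w = x * (1 - w)); last by ring.
  rewrite !powRM ?ltW //.
  rewrite (_ : _ * x = (x `^ p * x `^ q * x `^ 1) * (w `^ p * (1 - w) `^ q)); last first.
    by rewrite powRr1 ?ltW //; ring.
  by rewrite (powR_combine x p q (-1)) // (powR_combine x (-1) 1 0) ?addNr // powRr0 mul1r.
- by move=> u v _ _ uv; rewrite ltr_pM2l.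
- by rewrite derive1_scale => w _; exact: cst_continuous.
- by move=> w _; rewrite mulr_ge0 // powR_ge0.
- move=> w; rewrite in_itv/= mulr0 mulr1 => /andP[w0 w1].
  apply: cvgM; first exact: continuous_powR.
  apply: (continuous_powR_comp (fun t => x - t)); last by rewrite subr_gt0.
  by apply: cvgB; [exact: cvg_cst|exact: cvg_id].
Qed.

Lemma powR_le0_anti (a x y : R) : a <= 0 -> 0 < x -> x <= y -> y `^ a <= x `^ a.
Proof.
move=> a0 x0 xy; rewrite -(opprK a) !(powRN _ (- a)) lef_pV2 ?posrE ?powR_gt0 //; last lra.
by apply: ge0_ler_powR; rewrite ?nnegrE; lra.
Qed.

(** On each half of (0, 1) one of the two powers is at most its value at 1/2. *)
Lemma integrable_beta (p q : R) : -1 < p <= 0 -> -1 < q <= 0 ->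
  mu.-integrable setT (EFin \o (fun t => ker p 1 t * ker q 1 (1 - t))).
Proof.
move=> /andP[p1 p0] /andP[q1 q0].
pose c : R := 2^-1 `^ p + 2^-1 `^ q.
have c0 : 0 <= c by rewrite addr_ge0 // powR_ge0.
have ikr := integrable_reflect 1 _ (integrable_ker q 1 q1).
have mkr := integrable_measurable _ ikr.
have isum : mu.-integrable setT (fun t => (c%:E * ((ker p 1 t)%:E + (ker q 1 (1 - t))%:E))%E).
  apply: integrableZl => //; apply: integrableD => //; exact: integrable_ker.
apply: le_integrable isum => //.
  apply/measurable_EFinP; apply: measurable_funM => //; exact: measurable_ker.
move=> t _ /=; rewrite lee_fin !ger0_norm ?(mulr_ge0, addr_ge0, ker_ge0) //.
rewrite /ker; case: ifPn => [/andP[t0 t1]|_]; last first.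
  by rewrite mul0r add0r mulr_ge0 // -/(ker q 1 (1 - t)) ker_ge0.
rewrite ifT; last by apply/andP; split; lra.
have tp := powR_ge0 t p; have tq := powR_ge0 (1 - t) q.
have hp := powR_ge0 (2^-1) p; have hq := powR_ge0 (2^-1) q.
have [th|th] := leP t 2^-1.
- apply: (@le_trans _ _ (t `^ p * 2^-1 `^ q)).
    by rewrite ler_wpM2l //; apply: powR_le0_anti => //; lra.
  by rewrite mulrC; apply: ler_pM => //; rewrite /c; lra.
- apply: (@le_trans _ _ (2^-1 `^ p * (1 - t) `^ q)).
    by rewrite ler_wpM2r //; apply: powR_le0_anti => //; lra.
  by apply: ler_pM => //; rewrite /c; lra.
Qed.

(** Nonpositive exponents make both powers at least 1 on (0, 1). *)
Lemma beta_gt0 (p q : R) : -1 < p <= 0 -> -1 < q <= 0 -> 0 < beta p q.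
Proof.
move=> p01 q01; apply: (@lt_le_trans _ _ 1) => //.
have <- : \int[mu]_(t in `]0, 1[) (1 : R) = 1.
  by rewrite Rintegral_cst //= lebesgue_measure_itv /= lte_fin ltr01 mul1r -EFinB /= subr0.
rewrite /beta /conv Rintegral_mkcond; apply: le_Rintegral => //.
- rewrite -restrict_EFin; apply/integrable_restrict => //; rewrite setTI.
  apply: measurable_bounded_integrable => //=.
  + by rewrite lebesgue_measure_itv /= lte_fin ltr01 -EFinB ltry.
  + exact: bounded_cst.
- exact: integrable_beta.
- move=> t _; rewrite patchE; case: ifPn => [/set_mem|_]; last by rewrite mulr_ge0 // ker_ge0.
  rewrite /= in_itv/= => /andP[t0 t1]; rewrite /ker t0 t1 /= ifT; last by apply/andP; split; lra.
  move: p01 q01 => /andP[p1 p0] /andP[q1 q0].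
  have h (x a : R) : a <= 0 -> 0 < x -> x < 1 -> 1 <= x `^ a.
    move=> a0 x0 x1; have := powR_le0_anti a x 1 a0 x0 (ltW x1).
    by rewrite powR1.
  by rewrite -[leLHS](mul1r 1); apply: ler_pM => //; apply: h => //; lra.
Qed.

Section mobius_map.
Variables (p q s : R).
Hypotheses (p0 : 0 < p) (q0 : 0 < q).

(** The Moebius transformation that sends 0, 1 and infinity to s, s + p and
    s + p + q. *)
Definition mobius_map (w : R) : R := s + p * (p + q) * (w / (q + p * w)).

Let D_gt0 (w : R) : 0 <= w -> 0 < q + p * w.
Proof. by move=> w0; rewrite ltr_wpDr // mulr_ge0 // ltW. Qed.

Lemma is_derive_affine (w : R) : is_derive w 1 (fun w => q + p * w) p.
Proof.
apply: (is_derive_eq (@is_deriveD _ _ _ (cst q) (p *: id) w 1 0 (p *: 1) _ _)).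
by rewrite add0r /GRing.scale /= mulr1.
Qed.

Lemma is_derive_mobius_map (w : R) : 0 < q + p * w ->
  is_derive w 1 mobius_map (p * (p + q) * q / (q + p * w) ^+ 2).
Proof.
move=> Dw; have D0 : q + p * w != 0 by rewrite gt_eqF.
have dV := is_deriveV (f := fun w => q + p * w) D0 (is_derive_affine w).
have dM := is_deriveM (is_derive_id w 1) dV.
have dZ := is_deriveZ (p * (p + q)) dM.
have dF := is_deriveD (is_derive_cst s w 1) dZ.
apply: (is_derive_eq dF).
rewrite add0r /GRing.scale /= mulr1.
by field.
Qed.

Lemma derive1_mobius_map (w : R) : 0 < q + p * w ->
  derive1 mobius_map w = p * (p + q) * q / (q + p * w) ^+ 2.
Proof. by move=> /is_derive_mobius_map [_]; rewrite derive1E. Qed.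

Lemma continuous_derive1_mobius_map (w : R) : 0 <= w ->
  {for w, continuous (derive1 mobius_map)}.
Proof.
move=> /D_gt0 Dw.
have cD : {for w, continuous (fun w : R => q + p * w)}.
  apply/differentiable_continuous/derivable1_diffP.
  by have [] := is_derive_affine w.
have nD : \forall z \near w, 0 < q + p * z by have /cvgr_gt := cD; apply.
apply: (@cvg_trans _ ((fun z => p * (p + q) * q / (q + p * z) ^+ 2) @ w)).
  apply: near_eq_cvg; apply: filterS nD => z Dz; exact/esym/derive1_mobius_map.
rewrite derive1_mobius_map //.
suff : p * (p + q) * q / (q + p * z) ^+ 2 @[z --> w] --> p * (p + q) * q / (q + p * w) ^+ 2 by [].
apply: cvgMl_tmp; apply: cvgV; first by rewrite expf_neq0 // gt_eqF.
by apply: (@cvgM _ _ _ _ (fun w : R => q + p * w) (fun w : R => q + p * w)).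
Qed.

Lemma mobius_map0 : mobius_map 0 = s.
Proof. by rewrite /mobius_map mul0r mulr0 addr0. Qed.

Lemma mobius_map1 : mobius_map 1 = s + p.
Proof.
have pq0 : q + p != 0 by rewrite gt_eqF // addr_gt0.
by rewrite /mobius_map mulr1; field.
Qed.

Lemma mobius_map_subl (w : R) : mobius_map w - s = p * (p + q) * (w / (q + p * w)).
Proof. by rewrite /mobius_map addrC addKr. Qed.

Lemma mobius_map_subr (w : R) : 0 <= w ->
  s + p - mobius_map w = p * q * ((1 - w) / (q + p * w)).
Proof.
move=> /D_gt0 /gt_eqF/negbT D0; rewrite /mobius_map; by field.
Qed.

Lemma mobius_map_pole (w : R) : 0 <= w ->
  s + p + q - mobius_map w = q * (p + q) / (q + p * w).
Proof.
move=> /D_gt0 /gt_eqF/negbT D0; rewrite /mobius_map; by field.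
Qed.

Lemma mobius_map_incr : {in `[0, 1] &, {homo mobius_map : x y / x < y}}.
Proof.
move=> u v; rewrite !in_itv/= => /andP[u0 u1] /andP[v0 v1] uv.
have Du := D_gt0 u u0; have Dv := D_gt0 v v0.
rewrite /mobius_map ltrD2l ltr_pM2l; last by rewrite mulr_gt0 // addr_gt0.
rewrite ltr_pdivrMr // mulrAC ltr_pdivlMr //.
rewrite !mulrDr (mulrCA u p v) (mulrCA v p u) (mulrC v u) ltrD2r.
by rewrite ltr_pM2r.
Qed.
End mobius_map.

(** The Moebius substitution sends infinity to the pole t0, and the differences
    T - t, t - s and t0 - t become 1 - w, w and 1 up to constants and a common
    denominator.  The powers of that denominator, 2 from the integrand and -2 from
    the derivative, cancel, and the beta integrand remains. *)
Lemma mobius_integral (gamma s T t0 : R) : 0 < gamma < 1 -> s < T -> T < t0 ->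
  \int[mu]_(t in `]s, T[) ((T - t) `^ (- gamma) * (t - s) `^ (gamma - 1) / (t0 - t)) =
  beta (gamma - 1) (- gamma) * ((t0 - T) `^ (- gamma) * (t0 - s) `^ (gamma - 1)).
Proof.
move=> /andP[g0 g1] sT Tt.
pose p := T - s; pose q := t0 - T.
have p0 : 0 < p by rewrite subr_gt0.
have q0 : 0 < q by rewrite subr_gt0.
have pq0 : 0 < p + q by rewrite addr_gt0.
have ET : T = s + p by rewrite /p; ring.
have Et0 : t0 = s + p + q by rewrite /q /p; ring.
rewrite (_ : t0 - s = p + q); last by rewrite /p /q; ring.
rewrite (_ : t0 - T = q) // Et0 ET.
clearbody p q; clear ET Et0 Tt sT T t0.
rewrite betaE -[RHS]mulrC -RintegralZl; last 2 first.
- by [].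
- have g01 : -1 < gamma - 1 <= 0 by apply/andP; split; lra.
  have g02 : -1 < - gamma <= 0 by apply/andP; split; lra.
  have := integrable_beta _ _ g01 g02; rewrite (conv_ker_restrict _ _ 1 1) //.
  by rewrite -restrict_EFin => /integrable_restrict; rewrite setTI; exact.
apply: (f_equal fine).
transitivity (\int[mu]_(t in `](mobius_map p q s 0), (mobius_map p q s 1)[)
  ((s + p - t) `^ (- gamma) * (t - s) `^ (gamma - 1) / (s + p + q - t))%:E)%E.
  by rewrite mobius_map0 mobius_map1.
rewrite (ge0_integration_by_substitution_oo (mobius_map p q s)
  (fun t => ((s + p - t) `^ (- gamma) * (t - s) `^ (gamma - 1) / (s + p + q - t)))).
- apply: eq_integral => w /set_mem /=; rewrite in_itv/= => /andP[w0 w1].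
  congr EFin.
  have D0 : 0 < q + p * w by rewrite ltr_wpDr // mulr_ge0 // ltW.
  have w1' : 0 < 1 - w by rewrite subr_gt0.
  rewrite derive1_mobius_map // mobius_map_subr ?ltW // mobius_map_subl mobius_map_pole ?ltW //.
  have split_power (x : R) : 0 < x -> x `^ (gamma - 1) = x^-1 * (x `^ (- gamma))^-1.
    by move=> x0; rewrite -powR_inv1 ?ltW // -powRN; apply/esym/powR_combine => //; ring.
  have iD : 0 < (q + p * w)^-1 by rewrite invr_gt0.
  have := (ltW p0, ltW q0, ltW pq0, (ltW w0, ltW iD, ltW w1')) => -[[[? ?] ?] [[? ?] ?]].
  rewrite !powRM; try by rewrite ?mulr_ge0.
  rewrite !split_power // invrK.
  have := powR_gt0 (- gamma) p0; have := powR_gt0 (- gamma) q0.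
  have := powR_gt0 (- gamma) pq0; have := powR_gt0 (- gamma) w0.
  have := powR_gt0 (- gamma) iD; have := powR_gt0 (- gamma) w1'.
  set a1 := p `^ _; set a2 := q `^ _; set a3 := (p + q) `^ _; set a4 := w `^ _.
  set a5 := _^-1 `^ _; set a6 := (1 - w) `^ _.
  move=> h6 h5 h4 h3 h2 h1.
  field.
  by rewrite ?gt_eqF.
- exact: ltr01.
- exact: mobius_map_incr.
- move=> w; rewrite in_itv/= => /andP[w0 _].
  by have [] := @is_derive_mobius_map p q s w (ltr_wpDr (mulr_ge0 (ltW p0) w0) q0).
- move=> w; rewrite in_itv/= => /andP[w0 _].
  exact: continuous_derive1_mobius_map.
- rewrite mobius_map0 mobius_map1 // => t; rewrite in_itv/= => /andP[t1 t2].
  by rewrite !mulr_ge0 // ?powR_ge0 // invr_ge0; lra.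
- rewrite mobius_map0 mobius_map1 // => t; rewrite in_itv/= => /andP[t1 t2].
  have cs (c : R) : {for t, continuous (fun z => c - z)}.
    by apply: cvgB; [exact: cvg_cst|exact: cvg_id].
  apply: cvgM; last first.
    by apply: cvgV; [rewrite gt_eqF//; lra|exact: cs].
  apply: cvgM.
    by apply: (continuous_powR_comp (fun z => s + p - z)); [exact: cs|lra].
  apply: (continuous_powR_comp (fun z => z - s)); last lra.
  by apply: cvgB; [exact: cvg_id|exact: cvg_cst].
Qed.
End power_kernel.

(** * A Poisson formula for Abel integrals *)

Section poisson_formula.
Context {R : realType}.
Local Notation mu := (@lebesgue_measure R).
Variables (gamma S : R).
Hypotheses (g01 : 0 < gamma < 1) (S0 : 0 < S).
Local Notation g := (ker (gamma - 1) S).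
Local Notation B := (beta (gamma - 1) (- gamma)).

Let g0 : 0 < gamma. Proof. by case/andP: g01. Qed.
Let g1 : gamma < 1. Proof. by case/andP: g01. Qed.

Lemma beta_gamma_gt0 : 0 < B.
Proof. by have h0 := g0; have h1 := g1; apply: beta_gt0; apply/andP; split; lra. Qed.

(** The balayage onto (-oo, T) of the unit mass at x0 for the kernel g. *)
Definition poisson (T x0 t : R) : R :=
  B^-1 * (x0 - T) `^ gamma * ker (- gamma) T (T - t) * (x0 - t)^-1.

Lemma integrable_abel_kernel : mu.-integrable setT (EFin \o g).
Proof. by have h0 := g0; apply: integrable_ker; lra. Qed.

Lemma poisson_ge0 (T x0 t : R) : T < x0 -> 0 <= poisson T x0 t.
Proof.
move=> Tx0; rewrite /poisson.
have [tT|Tt] := leP T t.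
  by rewrite ker_le0 ?mulr0 ?mul0r // subr_le0.
rewrite !mulr_ge0 ?ker_ge0 ?powR_ge0 ?invr_ge0 ?(ltW beta_gamma_gt0) //; lra.
Qed.

Lemma integrable_poisson (T x0 : R) : T < x0 -> mu.-integrable setT (EFin \o poisson T x0).
Proof.
have h0 := g0; have h1 := g1; have hS := S0.
move=> Tx0.
have gm1 : -1 < - gamma by lra.
have ik := integrable_reflect T _ (integrable_ker (- gamma) T gm1).
(* The maximum is x0 - t where the kernel does not vanish, and it keeps the factor
   bounded and continuous everywhere. *)
pose h (t : R) := B^-1 * (x0 - T) `^ gamma * (Num.max (x0 - T) (x0 - t))^-1.
have mh : measurable_fun setT h.
  apply: measurable_funM => //; apply: continuous_measurable_fun => t.
  apply: cvgV.
    by rewrite gt_eqF // lt_max subr_gt0 Tx0.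
  apply: (@continuous_max R R (fun=> x0 - T) (fun x : R => x0 - x) t); first exact: cvg_cst.
  by apply: cvgB; [exact: cvg_cst|exact: cvg_id].
have := integrable_bounded_mul _ h (B^-1 * (x0 - T) `^ gamma * (x0 - T)^-1) ik mh.
have -> : poisson T x0 = (fun t => ker (- gamma) T (T - t) * h t).
  apply/funext => t; rewrite /poisson /h.
  have [tT|Tt] := leP T t.
    by rewrite ker_le0 ?mulr0 ?mul0r // subr_le0.
  rewrite max_r; last lra.
  by ring.
apply => t.
have b0 := beta_gamma_gt0.
have xT : 0 < x0 - T by rewrite subr_gt0.
rewrite /h normrM ger0_norm ?mulr_ge0 ?powR_ge0 ?invr_ge0 ?(ltW b0) //.
apply: ler_wpM2l; first by rewrite mulr_ge0 ?powR_ge0 ?invr_ge0 ?(ltW b0).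
rewrite ger0_norm ?invr_ge0; last by rewrite le_max (ltW xT).
rewrite lef_pV2 ?posrE //; first by rewrite le_max lexx.
by rewrite lt_max xT.
Qed.

(** The balayage [poisson T x0] and the unit mass at x0 have the same potential
    before T; this is what fixes the formula for [poisson]. *)
Lemma conv_poisson (T x0 x : R) : 0 <= x -> x < T -> T < x0 -> x0 < S ->
  conv (poisson T x0) (fun s => g (- s)) x = g (x0 - x).
Proof.
have h0 := g0; have h1 := g1; have hS := S0.
move=> x00 xT Tx0 x0S.
have xS : 0 < x0 - T by rewrite subr_gt0.
transitivity (B^-1 * (x0 - T) `^ gamma *
   \int[mu]_(t in `]x, T[) ((T - t) `^ (- gamma) * (t - x) `^ (gamma - 1) / (x0 - t))).
  rewrite Rintegral_mkcond -RintegralZl_measurable.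
    rewrite /conv; apply: eq_Rintegral => t _.
    rewrite patchE /poisson opprB.
    have [/andP[xt tT]|out] := boolP (x < t < T).
      by rewrite mem_set /= ?in_itv/= ?xt ?tT // !ker_in; lra.
    rewrite memNset /= ?in_itv/= ?mulr0; last by apply/negP.
    move: out; rewrite negb_and -!leNgt => /orP[tx|Tt].
      by rewrite [X in _ * X]ker_le0 ?mulr0 // subr_le0.
    by rewrite ker_le0 ?mulr0 ?mul0r // subr_le0.
  apply/(measurable_restrictT _ _).1 => //.
  have mpow (a c : R) : measurable_fun setT (fun t : R => (c - t) `^ a).
    by apply: (measurable_comp_sub c (fun t => t `^ a)); exact: measurable_powR.
  apply: measurable_funM; first apply: measurable_funM => //.
  - by apply: measurable_funTS; exact: mpow.
  - apply: measurable_funTS.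
    by apply: (measurableT_comp (measurable_powR _)); exact: measurable_funB.
  - apply: open_continuous_measurable_fun => // t /set_mem /=; rewrite in_itv/= => /andP[_ tT].
    apply: cvgV; first by rewrite gt_eqF // subr_gt0; lra.
    by apply: cvgB; [exact: cvg_cst|exact: cvg_id].
rewrite mobius_integral //.
have b0 := beta_gamma_gt0.
rewrite powRN ker_in; try lra.
have := powR_gt0 gamma xS; set a := _ `^ gamma; move=> a0.
by field; rewrite ?gt_eqF.
Qed.

Lemma conv_poisson_out (T x0 x : R) : T <= x ->
  conv (poisson T x0) (fun s => g (- s)) x = 0.
Proof.
move=> Tx; rewrite /conv; apply: Rintegral_eq0 => t.
have [tT|Tt] := leP T t.
  by rewrite /poisson ker_le0 ?mulr0 ?mul0r // subr_le0.
by rewrite [X in _ * X]ker_le0 ?mulr0 //; lra.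
Qed.

Lemma conv_reflect (a D : R -> R) (x : R) : measurable_fun setT a -> measurable_fun setT D ->
  conv a D x = \int[mu]_t (D t * a (x - t)).
Proof.
move=> ma mD; rewrite /conv -(Rintegral_reflect x).
  by apply: eq_Rintegral => t _; rewrite subKr mulrC.
by apply: measurable_funM => //; exact: measurable_comp_sub.
Qed.

Lemma integrable_abel_cut (D : R -> R) (P : R -> bool) (M x0 : R) :
  measurable_fun setT D -> (forall x, `|D x| <= M) -> measurable_fun setT P ->
  mu.-integrable setT (EFin \o (fun t => D t * (if P t then g (x0 - t) else 0))).
Proof.
move=> mD DM mP.
pose h t := D t * (if P t then 1 else 0).
have mh : measurable_fun setT h by apply: measurable_funM => //; exact: measurable_fun_ifT.
have igr := integrable_reflect x0 _ integrable_abel_kernel.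
have := integrable_bounded_mul _ h M igr mh.
rewrite (_ : (fun t => _) = (fun t => D t * (if P t then g (x0 - t) else 0))).
  apply => t; rewrite /h; case: ifP => _; rewrite ?mulr0 ?mulr1 // normr0.
  exact: le_trans (DM 0).
by apply/funext => t; rewrite /h; case: ifP => _; ring.
Qed.

(** For t < T, [conv_poisson] writes g (x0 - t) as a superposition of the kernels
    g (r - t) with r < T; exchanging the integrals gives the first term. *)
Lemma conv_split (D : R -> R) (M T x0 : R) :
  measurable_fun setT D -> (forall x, `|D x| <= M) -> (forall x, x < 0 -> D x = 0) ->
  T < x0 -> x0 < S ->
  conv g D x0 = \int[mu]_t (poisson T x0 t * conv g D t) +
                \int[mu]_t (D t * (if T <= t then g (x0 - t) else 0)).
Proof.
move=> mD DM D0 Tx0 x0S.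
have mg : measurable_fun setT g := measurable_ker _ _.
have ig := integrable_abel_kernel; have ip := integrable_poisson T x0 Tx0.
have igr : mu.-integrable setT (EFin \o (fun t => g (x0 - t))) by exact: integrable_reflect.
have mT : measurable_fun setT (fun t : R => T <= t) by exact: measurable_fun_ler.
have -> : \int[mu]_t (poisson T x0 t * conv g D t) =
    \int[mu]_t (poisson T x0 t * \int[mu]_s (g (- s) * D (s + t))).
  apply: eq_Rintegral => t _; congr (_ * _); rewrite /conv.
  rewrite -(Rintegral_opp (fun s => g s * D (t - s))).
    by apply: eq_Rintegral => s _; rewrite opprK (addrC t s).
  by apply: measurable_funM => //; exact: measurable_comp_sub.
rewrite (conv_swap _ _ _ M) //; last first.
  by have := integrable_reflect 0 _ ig; under eq_fun do rewrite sub0r.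
rewrite conv_reflect //.
have mT' : measurable_fun setT (fun t : R => t < T) by exact: measurable_fun_ltr.
have i1 := integrable_abel_cut D (fun t => t < T) M x0 mD DM mT'.
have i2 := integrable_abel_cut D (fun t => T <= t) M x0 mD DM mT.
have -> : \int[mu]_t (D t * conv (poisson T x0) (fun s => g (- s)) t) =
    \int[mu]_t (D t * (if t < T then g (x0 - t) else 0)).
  apply: eq_Rintegral => t _.
  have [t0|t0] := ltP t 0; first by rewrite D0 // !mul0r.
  by have [tT|Tt] := ltP t T; [rewrite conv_poisson|rewrite conv_poisson_out].
rewrite -RintegralD //.
by apply: eq_Rintegral => t _; case: ltP => _; ring.
Qed.

(** The kernel g has mass of order (x0 - T)^gamma on an interval of length x0 - T.
    The length is doubled so that the end point t = T lies in the open support of the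
    truncated power. *)
Lemma conv_tail_ge (D : R -> R) (M K T x0 : R) :
  measurable_fun setT D -> (forall x, `|D x| <= M) -> T < x0 -> 0 <= K ->
  (forall t, T <= t < x0 -> - K <= D t) ->
  - K * ((2 * (x0 - T)) `^ gamma / gamma) <=
    \int[mu]_t (D t * (if T <= t then g (x0 - t) else 0)).
Proof.
move=> mD DM Tx0 K0 DK.
have h0 := g0.
have mg : measurable_fun setT g := measurable_ker _ _.
have mT : measurable_fun setT (fun t : R => T <= t) by exact: measurable_fun_ler.
have i2 := integrable_abel_cut D (fun t => T <= t) M x0 mD DM mT.
have x2 : 0 < 2 * (x0 - T) by rewrite mulr_gt0 // subr_gt0.
have gm1 : -1 < gamma - 1 by lra.
rewrite -Rintegral_ker // -RintegralZl //; last exact: integrable_ker.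
rewrite -(Rintegral_reflect x0); last first.
  by apply: measurable_funM => //; exact: measurable_ker.
apply: le_Rintegral => //.
- apply: (integrable_reflect x0 (fun x => - K * ker (gamma - 1) (2 * (x0 - T)) x)).
  have := integrableZl measurableT (- K) (integrable_ker (gamma - 1) (2 * (x0 - T)) gm1).
  by under eq_fun do rewrite -EFinM.
- move=> t _; case: ifPn => [Tt|]; last first.
    by rewrite mulr0 mulNr oppr_le0 mulr_ge0 // ker_ge0.
  have [tx|xt] := ltP t x0; last by rewrite !ker_le0 ?mulr0 // subr_le0.
  have gle : g (x0 - t) <= ker (gamma - 1) (2 * (x0 - T)) (x0 - t).
    rewrite [leRHS]ker_in; try lra.
    by rewrite /ker; case: ifP => // _; exact: powR_ge0.
  have Dt : - K <= D t by apply: DK; rewrite Tt.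
  have gge := ker_ge0 (gamma - 1) S (x0 - t).
  apply: (@le_trans _ _ (- K * g (x0 - t))); last exact: ler_wpM2r.
  by rewrite !mulNr lerN2 ler_wpM2l.
Qed.
End poisson_formula.

Lemma conv_le0 {R : realType} (a S x : R) (D : R -> R) :
  (forall x, x < 0 -> D x = 0) -> x <= 0 -> conv (ker a S) D x = 0.
Proof.
move=> D0 x0; apply: Rintegral_eq0 => t.
have [t0|t0] := leP t 0; first by rewrite ker_le0 ?mul0r.
by rewrite D0 ?mulr0 //; lra.
Qed.

(** * Positivity of increments *)

Section first_crossing.
Context {R : realType}.

Lemma first_nonpos (Z : R -> R) (h x1 : R) :
  0 < h -> (forall x, 0 < x <= h -> 0 < Z x) ->
  (forall x, 0 < x <= x1 -> {for x, continuous Z}) -> 0 < x1 -> Z x1 <= 0 ->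
  exists x0, [/\ h < x0, x0 <= x1, Z x0 <= 0 & forall x, 0 < x < x0 -> 0 < Z x].
Proof.
move=> h0 Zh cZ x10 Zx1.
pose A := [set x | 0 < x /\ Z x <= 0].
have Ax1 : A x1 by split.
have hA x : A x -> h < x.
  by move=> [x0 Zx]; rewrite ltNge; apply/negP => xh; have := Zh x; rewrite x0 xh ltNge Zx => /(_ isT).
have hi : has_inf A by split; [exists x1|exists h => x /hA/ltW].
pose x0 := inf A.
have x0x1 : x0 <= x1 by apply: ge_inf => //; exact: hi.2.
have hx0 : h <= x0 by apply: lb_le_inf; [exists x1|move=> x /hA/ltW].
have x00 : 0 < x0 by lra.
have pos x : 0 < x < x0 -> 0 < Z x.
  move=> /andP[xp xx0]; rewrite ltNge; apply/negP => Zx.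
  have : x0 <= x by apply: ge_inf; [exact: hi.2|split].
  by rewrite leNgt xx0.
have Zx0 : Z x0 <= 0.
  rewrite leNgt; apply/negP => Zx0.
  have cZ0 : {for x0, continuous Z} by apply: cZ; rewrite x00.
  have /cvgr_gt := cZ0 => /(_ _ Zx0) [e /= e0 he].
  have [a Aa ax] : exists2 a, A a & a < x0 + e.
    by apply: inf_adherent.
  have x0a : x0 <= a by apply: ge_inf => //; exact: hi.2.
  have : 0 < Z a by apply: he; rewrite /ball_/= distrC ger0_norm; lra.
  by case: Aa => _; rewrite ltNge => ->.
exists x0; split=> //; rewrite lt_neqAle hx0 andbT; apply/eqP => hx.
have := Zh x0; rewrite x00 -hx lexx => /(_ isT); rewrite hx.
by rewrite ltNge Zx0.
Qed.
End first_crossing.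

Section monotonicity.
Context {R : realType}.
Local Notation mu := (@lebesgue_measure R).
Variables (gamma S : R).
Hypotheses (g01 : 0 < gamma < 1) (S0 : 0 < S).
Local Notation g := (ker (gamma - 1) S).
Local Notation B := (beta (gamma - 1) (- gamma)).

(** The lower bound has the order (x0 - T)^gamma of the bound in [conv_tail_ge], so
    that the two terms of [conv_split] can be compared as T tends to x0. *)
Lemma poisson_ge (T x0 t : R) : t < T -> T < x0 -> x0 - t <= S -> 0 < t ->
  B^-1 * (x0 - T) `^ gamma * S `^ (- gamma) * S^-1 <= poisson gamma T x0 t.
Proof.
move=> tT Tx0 xtS t0; have /andP[gam0 gam1] := g01; have hS := S0.
have b0 : 0 < B by exact: beta_gamma_gt0.
have S1 : S^-1 <= (x0 - t)^-1 by rewrite lef_pV2 ?posrE //; lra.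
have S2 : S `^ (- gamma) <= (T - t) `^ (- gamma) by apply: powR_le0_anti; lra.
rewrite /poisson ker_in; try lra.
apply: ler_pM => //.
- by rewrite !mulr_ge0 ?powR_ge0 // invr_ge0 ltW.
- by rewrite invr_ge0 ltW.
- by apply: ler_wpM2l => //; rewrite mulr_ge0 ?powR_ge0 // invr_ge0 ltW.
Qed.

(** In [conv_split] the first term is at least a fixed multiple of (x0 - T)^gamma,
    because of the interval (h1, h2).  If Z x0 were nonpositive, then Z would be
    arbitrarily small on [T, x0) for T close to x0, and the second term could not
    compensate the first. *)
Lemma conv_pos_at (D Z : R -> R) (C L M m h1 h2 x0 : R) :
  0 < C -> 0 <= L -> measurable_fun setT D -> (forall x, `|D x| <= M) ->
  (forall x, x < 0 -> D x = 0) ->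
  (forall x, 0 < x <= x0 -> Z x = C * conv g D x) ->
  (forall x, 0 < x < x0 -> 0 <= Z x) -> {for x0, continuous Z} ->
  0 < h1 -> h1 < h2 -> h2 < x0 -> x0 < S ->
  0 < m -> (forall x, h1 < x < h2 -> m <= Z x) ->
  (forall x, h2 <= x < x0 -> - (L * Z x) <= D x) ->
  0 < Z x0.
Proof.
move=> C0 L0 mD DM D0 ZE Z0 cZ h10 h12 h2x0 x0S m0 Zm DZ.
rewrite ltNge; apply/negP => Zx0.
have /andP[gam0 gam1] := g01.
have b0 : 0 < B by exact: beta_gamma_gt0.
have Sg := powR_gt0 (- gamma) S0.
have t2 : 0 < (2 : R) `^ gamma by exact: powR_gt0.
pose A := B^-1 * S `^ (- gamma) * S^-1 * m * (h2 - h1).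
have A0 : 0 < A by rewrite !mulr_gt0 ?invr_gt0 // subr_gt0.
have AE : A = B^-1 * S `^ (- gamma) * S^-1 * m * (h2 - h1) by [].
clearbody A.
(* With this e the second term of the Poisson formula is less than half of the
   first. *)
pose e := A * gamma / (2 * (C * L + 1) * 2 `^ gamma).
have CL : 0 < C * L + 1 by have := mulr_ge0 (ltW C0) L0; lra.
have e0 : 0 < e by apply: divr_gt0; rewrite !mulr_gt0.
have [T [h2T Tx0 ZT]] : exists T, [/\ h2 < T, T < x0 & forall x, T <= x < x0 -> Z x <= e].
  have Ze : Z x0 < e by lra.
  have /cvgr_lt := cZ => /(_ _ Ze) [d /= d0 hd].
  exists (Num.max ((h2 + x0) / 2) (x0 - d / 2)); split.
  - by rewrite lt_max; apply/orP; left; lra.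
  - by rewrite gt_max; apply/andP; split; lra.
  - move=> x; rewrite ge_max => /andP[/andP[xa xb] xx]; apply/ltW/hd.
    by rewrite /ball_/= ger0_norm; lra.
pose w := (x0 - T) `^ gamma.
have xT : 0 < x0 - T by lra.
have w0 : 0 < w by exact: powR_gt0.
have CZ x : 0 < x <= x0 -> conv g D x = C^-1 * Z x.
  by move=> xx; rewrite ZE // mulKf // gt_eqF.
have x0x0 : 0 < x0 <= x0 by rewrite lexx andbT; lra.
have split_eq := @conv_split _ gamma S g01 S0 D M T x0 mD DM D0 Tx0 x0S.
have K0 : 0 <= L * e by rewrite mulr_ge0 // ltW.
have tail := @conv_tail_ge _ gamma S g01 D M (L * e) T x0 mD DM Tx0 K0.
have {}tail := tail _.
have hK t : T <= t < x0 -> - (L * e) <= D t.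
  move=> tt; apply: (@le_trans _ _ (- (L * Z t))).
    by rewrite lerN2 ler_wpM2l // ZT.
  by apply: DZ; move/andP: tt => [t1 t2']; rewrite t2' andbT; lra.
have {}tail := tail hK.
have ig := @integrable_abel_kernel _ gamma S g01.
have ip := @integrable_poisson _ gamma S g01 S0 T x0 Tx0.
have main : C^-1 * (w * A) <= \int[mu]_t (poisson gamma T x0 t * conv g D t).
  have -> : C^-1 * (w * A) = \int[mu]_(t in `]h1, h2[) (C^-1 * w * B^-1 * S `^ (- gamma) * S^-1 * m).
    by rewrite Rintegral_cst //= lebesgue_measure_itv /= lte_fin h12 /= AE; ring.
  rewrite Rintegral_mkcond; apply: le_Rintegral => //.
  - rewrite -restrict_EFin; apply/integrable_restrict => //; rewrite setTI.
    apply: measurable_bounded_integrable => //=.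
    + by rewrite lebesgue_measure_itv /= lte_fin h12 -EFinB ltry.
    + exact: bounded_cst.
  - apply: (integrable_bounded_mul _ _ _ ip (measurable_conv _ _ M ig mD DM)).
    exact: (conv_bounded _ _ M ig mD DM).
  - move=> t _; rewrite patchE; case: ifPn => [/set_mem /=|].
      rewrite in_itv/= => /andP[t1 t2'].
      rewrite CZ; last by apply/andP; split; lra.
      rewrite (_ : C^-1 * w * _ * _ * _ * _ = B^-1 * w * S `^ (- gamma) * S^-1 * (C^-1 * m)); last by ring.
      apply: ler_pM.
      - by rewrite !mulr_ge0 ?powR_ge0 // invr_ge0 ltW.
      - by apply: mulr_ge0; rewrite ?invr_ge0; exact: ltW.
      - by apply: poisson_ge; lra.
      - by rewrite ler_pM2l ?invr_gt0 // Zm // t1.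
    move=> _.
    have [t0|t0] := leP t 0.
      by rewrite conv_le0 ?mulr0.
    have [tT|Tt] := ltP t T; last by rewrite /poisson ker_le0 ?mulr0 ?mul0r // subr_le0.
    by rewrite mulr_ge0 ?poisson_ge0 // CZ ?mulr_ge0 ?invr_ge0 ?(ltW C0) ?Z0 //; apply/andP; split; lra.
have Zc := ZE x0 x0x0.
move: Zx0; rewrite Zc pmulr_rle0 // split_eq leNgt => /negP; apply.
apply: (@lt_le_trans _ _ (C^-1 * (w * A) + - (L * e) * ((2 * (x0 - T)) `^ gamma / gamma))); last exact: lerD.
rewrite powRM //; last exact: ltW.
rewrite -/w.
have -> : C^-1 * (w * A) + - (L * e) * (2 `^ gamma * w / gamma) =
    w * A * ((C * L + 2) / (2 * C * (C * L + 1))).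
  by rewrite /e; field; rewrite !gt_eqF.
have CL2 : 0 < C * L + 2 by clear -CL; lra.
apply: mulr_gt0; first exact: mulr_gt0.
by apply: divr_gt0 => //; rewrite !mulr_gt0.
Qed.

Lemma conv_ker_ge (F : R -> R) (M m x : R) :
  measurable_fun setT F -> (forall x, `|F x| <= M) -> (forall x, x < 0 -> F x = 0) ->
  0 <= m -> 0 < x -> x < S -> (forall t, 0 <= t < x -> m <= F t) ->
  m * (x `^ gamma / gamma) <= conv g F x.
Proof.
move=> mF FM F0 m0 x0 xS Fm; have /andP[gam0 gam1] := g01.
have gm : -1 < gamma - 1 by lra.
rewrite -Rintegral_ker // -RintegralZl //; last exact: integrable_ker.
apply: le_Rintegral => //.
- have := integrableZl measurableT m (integrable_ker (gamma - 1) x gm).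
  by apply: eq_integrable => // t _ /=; rewrite -EFinM.
- exact: (integrable_conv_integrand _ _ M (@integrable_abel_kernel _ gamma S g01) mF FM).
- move=> t _.
  have [t0|t0] := leP t 0; first by rewrite !ker_le0 // mul0r mulr0.
  have [tx|xt] := ltP t x.
    rewrite !ker_in //; last exact: lt_trans xS.
    by rewrite mulrC ler_wpM2l ?powR_ge0 // Fm //; apply/andP; split; lra.
  rewrite {1}/ker ltNge [t < x]ltNge xt andbF mulr0.
  have [e|xt'] := eqVneq x t; last first.
    by rewrite (F0 (x - t)) ?mulr0 // subr_lt0 lt_neqAle xt' xt.
  rewrite -e subrr mulr_ge0 ?ker_ge0 //.
  by apply: le_trans m0 (Fm _ _); rewrite lexx.
Qed.

(** The increments of y over a step h <= h0 satisfy the Volterra equation driven by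
    the increments of F.  They are positive on (0, h], where y (x - h) = 0, and
    [conv_pos_at] excludes a first zero beyond h.  Longer steps are cut into short
    ones. *)
Lemma strictly_increasing_of_pos (y F : R -> R) (C L M m h0 : R) :
  0 < C -> 0 <= L -> measurable_fun setT F -> (forall x, `|F x| <= M) ->
  (forall x, x < 0 -> F x = 0) -> (forall x, x <= 0 -> y x = 0) ->
  (forall x, 0 < x < S -> y x = C * conv g F x) ->
  (forall x, x < S -> {for x, continuous y}) ->
  (forall s t, 0 <= s < S -> 0 <= t < S -> `|F s - F t| <= L * `|y s - y t|) ->
  0 < m -> 0 < h0 -> h0 < S -> (forall x, 0 <= x <= h0 -> m <= F x) ->
  forall s t, 0 <= s -> s < t -> t < S -> y s < y t.
Proof.
move=> C0 L0 mF FM F0 y0 yE cy lip m0 h00 h0S Fm.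
have /andP[gam0 gam1] := g01.
have ig := @integrable_abel_kernel _ gamma S g01.
have M0 : 0 <= M := le_trans (normr_ge0 _) (FM 0).
have yE' x : x < S -> y x = C * conv g F x.
  move=> xS; have [x0|x0] := leP x 0; first by rewrite y0 // conv_le0 ?mulr0.
  by rewrite yE // x0.
have ylow x : 0 < x <= h0 -> C * (m * (x `^ gamma / gamma)) <= y x.
  move=> /andP[x0 xh]; have xS : x < S := le_lt_trans xh h0S.
  rewrite yE' // ler_pM2l //; apply: (conv_ker_ge _ M) => //; first exact: ltW.
  move=> t /andP[t0 tx].
  by apply: Fm; rewrite t0 /=; lra.
have step h x : 0 < h <= h0 -> 0 < x < S -> y (x - h) < y x.
  move=> /andP[hp hh] /andP[x00 xS].
  rewrite ltNge; apply/negP => Zx.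
  (* A nonpositive increment somewhere yields a first zero x0 of Z. *)
  pose Z z := y z - y (z - h).
  have Zh z : 0 < z <= h -> 0 < Z z.
    move=> /andP[z0 zh]; rewrite /Z (y0 (z - h)) ?subr0; last by rewrite subr_le0.
    apply: lt_le_trans (ylow z _); last by rewrite z0 /=; lra.
    by rewrite !mulr_gt0 ?powR_gt0 ?invr_gt0.
  have cZ z : z < S -> {for z, continuous Z}.
    move=> zS; apply: cvgB; first exact: cy.
    apply: (@continuous_comp _ _ _ (fun z => z - h) y).
      by apply: cvgB; [exact: cvg_id|exact: cvg_cst].
    by apply: cy; lra.
  have [||x0 [hx0 x0x Zx0 Zpos]] := @first_nonpos R Z h x hp Zh _ x00.
  - by move=> z /andP[_ zx]; apply: cZ; lra.
  - by rewrite /Z subr_le0.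
  pose D z := F z - F (z - h).
  have mFh : measurable_fun setT (fun z : R => F (z - h)).
    by apply: (measurableT_comp mF); exact: measurable_funB.
  have x0S : x0 < S by lra.
  have h2p : 0 < h / 2 by lra.
  have hh2 : h / 2 < h by lra.
  suff : 0 < Z x0 by rewrite ltNge Zx0.
  apply: (@conv_pos_at D Z C L (M + M) (C * (m * ((h / 2) `^ gamma / gamma))) (h / 2) h x0) => //.
  - exact: measurable_funB.
  - by move=> z; apply: le_trans (ler_normB _ _) _; apply: lerD.
  - by move=> z z0; rewrite /D !F0 ?subrr //; lra.
  - move=> z /andP[z0 zx0]; rewrite /Z !yE' //; try lra.
    rewrite -mulrBr; congr (_ * _); rewrite /conv -RintegralB //.
    + by apply: eq_Rintegral => t _; rewrite /D mulrBr [z - h - t]addrAC.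
    + exact: (integrable_conv_integrand _ _ M ig mF FM).
    + exact: (integrable_conv_integrand _ _ M ig mF FM).
  - by move=> z /Zpos /ltW.
  - exact: cZ.
  - by rewrite !mulr_gt0 ?powR_gt0 ?invr_gt0.
  - move=> z /andP[z1 z2]; rewrite /Z (y0 (z - h)) ?subr0; last by rewrite subr_le0 ltW.
    apply: le_trans (ylow z _); last by apply/andP; split; lra.
    rewrite !ler_pM2l // ler_pM2r ?invr_gt0 //.
    by apply: ge0_ler_powR; rewrite ?nnegrE; lra.
  - move=> z /andP[z1 z2]; rewrite /D lerNl.
    have := lip z (z - h); rewrite -/(Z z) (ger0_norm (ltW (Zpos z _))); last by apply/andP; split; lra.
    by move=> /(_ _ _) hl; rewrite -normrN in hl; apply: le_trans (ler_norm _) (hl _ _); apply/andP; split; lra.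
move=> s t s0 st tS.
(* The n + 3 steps of length h lead from s to t. *)
have [n hn] := small_fraction (t - s) h0 h00.
pose h := (t - s) / (n%:R + 3).
have hp : 0 < h by rewrite divr_gt0 // subr_gt0.
have tE : s + n.+3%:R * h = t.
  by rewrite /h -addn3 natrD mulrC divfK ?subrKC // gt_eqF.
have inS k : (k < n.+3)%N -> 0 < s + k.+1%:R * h < S.
  move=> kn; have : (k.+1%:R : R) * h <= n.+3%:R * h by rewrite ler_pM2r // ler_nat.
  have : 0 < (k.+1%:R : R) * h by rewrite mulr_gt0.
  by move=> k0 kn'; apply/andP; split; lra.
have chain k : (k < n.+3)%N -> y s < y (s + k.+1%:R * h).
  elim: k => [_|k IH kn].
    rewrite -[X in y X < _](addrK h s) -[X in y (_ + X - _)]mul1r.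
    apply: step; first by rewrite hp ltW.
    by have := inS 0%N isT.
  apply: lt_trans (IH (ltnW kn)) _.
  rewrite (_ : s + k.+1%:R * h = s + k.+2%:R * h - h); last first.
    by rewrite -[in RHS]natr1; ring.
  by apply: step; [rewrite hp ltW|exact: inS].
by have := chain n.+2 (ltnSn _); rewrite tE.
Qed.
End monotonicity.

(** * The equilibrium solution *)

Section uniqueness.
Context {R : realType}.
Local Notation mu := (@lebesgue_measure R).
Variables (gamma S : R).
Hypotheses (g01 : 0 < gamma < 1) (S0 : 0 < S).
Local Notation g := (ker (gamma - 1) S).

Lemma conv_ker_le (F : R -> R) (M K x tau : R) :
  measurable_fun setT F -> (forall x, `|F x| <= M) -> 0 < tau ->
  (forall t, 0 < t < tau -> `|F (x - t)| <= K) -> (forall t, tau <= t -> F (x - t) = 0) ->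
  `|conv g F x| <= K * (tau `^ gamma / gamma).
Proof.
move=> mF FM tau0 FK Fout; have /andP[gam0 gam1] := g01.
have gm : -1 < gamma - 1 by lra.
have ig := @integrable_abel_kernel _ gamma S g01.
have ii := integrable_conv_integrand _ _ M ig mF FM x.
apply: le_trans (le_normr_Rintegral measurableT ii) _.
rewrite -Rintegral_ker // -RintegralZl //; last exact: integrable_ker.
apply: le_Rintegral => //.
- exact: integrable_norm.
- have := integrableZl measurableT K (integrable_ker (gamma - 1) tau gm).
  by apply: eq_integrable => // t _ /=; rewrite -EFinM.
- move=> t _.
  have [t0|t0] := leP t 0; first by rewrite !ker_le0 // mul0r mulr0 normr0.
  have [tt|tt] := ltP t tau; last first.
    by rewrite Fout // mulr0 normr0 /ker [t < tau]ltNge tt andbF mulr0.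
  have Kt : `|F (x - t)| <= K by apply: FK; rewrite t0.
  have K0 : 0 <= K := le_trans (normr_ge0 _) Kt.
  rewrite normrM ger0_norm ?ker_ge0 // mulrC; apply: ler_pM; rewrite ?ker_ge0 //.
  by rewrite [leRHS]ker_in // /ker; case: ifP => // _; exact: powR_ge0.
Qed.

(** If y vanishes up to time n tau, only the last tau units of time contribute to the
    convolution on the next stretch.  For small tau this bounds the supremum of |y|
    there by half of itself. *)
Lemma zero_of_volterra (y F : R -> R) (C L M : R) :
  0 < C -> 0 <= L -> measurable_fun setT F -> (forall x, `|F x| <= M) ->
  (forall x, x < 0 -> F x = 0) -> (forall x, x <= 0 -> y x = 0) ->
  (forall x, 0 < x < S -> y x = C * conv g F x) ->
  (forall s, 0 <= s < S -> `|F s| <= L * `|y s|) ->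
  forall s, s < S -> y s = 0.
Proof.
move=> C0 L0 mF FM F0 y0 yE lip.
have /andP[gam0 gam1] := g01.
have ig := @integrable_abel_kernel _ gamma S g01.
have yE' x : x < S -> y x = C * conv g F x.
  move=> xS; have [x0|x0] := leP x 0; first by rewrite y0 // conv_le0 ?mulr0.
  by rewrite yE // x0.
have [N yN] : exists N : R, forall x : R, x < S -> `|y x| <= N.
  exists (C * ((\int[mu]_t `|g t|) * M)) => x xS.
  rewrite yE' // normrM (gtr0_norm C0) ler_pM2l //.
  exact: conv_bounded.
have [tau tau0 htau] : exists2 tau : R, 0 < tau & C * L * (tau `^ gamma / gamma) <= 2^-1.
  have CL : 0 < 2 * (C * L + 1).
    by have := mulr_ge0 (ltW C0) L0; lra.
  (* This tau solves tau^gamma / gamma = 1 / (2 (C L + 1)). *)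
  exists ((gamma / (2 * (C * L + 1))) `^ gamma^-1).
    by rewrite powR_gt0 // divr_gt0.
  rewrite -powRrM mulVf ?gt_eqF // powRr1; last by rewrite divr_ge0 ?ltW.
  rewrite (_ : _ * _ = C * L / (2 * (C * L + 1))); last by field; rewrite !gt_eqF //; lra.
  by rewrite ler_pdivrMr // mulrA mulVf // mul1r; lra.
suff claim n : forall x, x <= n%:R * tau -> x < S -> y x = 0.
  move=> s sS; have [s0|s0] := leP s 0; first exact: y0.
  apply: (claim (Num.bound (s / tau))) => //.
  by rewrite -ler_pdivrMr // ltW // archi_boundP // divr_ge0 // ltW.
elim: n => [|n IH] x; first by rewrite mul0r => x0 _; exact: y0.
pose A := [set `|y z| | z in [set z | z <= n.+1%:R * tau /\ z < S]].
move=> xn xS.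
have Ax : A `|y x| by exists x.
have hA : has_sup A.
  by split; [exists (`|y x|)|exists N => _ [z [_ zS] <-]; exact: yN].
have s0 : 0 <= sup A := le_trans (normr_ge0 (y x)) (ub_le_sup hA.2 Ax).
suff half : sup A <= 2^-1 * sup A.
  have s1 : sup A <= 0 by lra.
  apply/eqP; rewrite -normr_le0; apply: le_trans s1.
  exact: (ub_le_sup hA.2 Ax).
apply: sup_le_ub; first exact: hA.1.
move=> _ [z [zn zS] <-].
rewrite yE' // normrM (gtr0_norm C0).
have bound t : 0 < t -> `|F (z - t)| <= L * sup A.
  move=> t0; have [zt|zt] := ltP (z - t) 0.
    by rewrite F0 // normr0 mulr_ge0.
  have ztS : z - t < S by lra.
  apply: le_trans (lip _ _) _; first by rewrite zt.
  rewrite ler_wpM2l //; apply: (ub_le_sup hA.2).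
  by exists (z - t) => //; split => //; lra.
have out t : tau <= t -> F (z - t) = 0.
  move=> tt; have [zt|zt] := ltP (z - t) 0; first exact: F0.
  have ztS : z - t < S by lra.
  have zt0 : y (z - t) = 0.
    by apply: IH => //; move: zn; rewrite -natr1 mulrDl mul1r; lra.
  apply/eqP; rewrite -normr_le0; apply: le_trans (lip _ _) _; first by rewrite zt.
  by rewrite zt0 normr0 mulr0.
have := conv_ker_le F M (L * sup A) z tau mF FM tau0 _ out.
move=> /(_ _); have h t : 0 < t < tau -> `|F (z - t)| <= L * sup A by move=> /andP[/bound].
move=> /(_ h) hc; apply: (@le_trans _ _ (C * (L * sup A * (tau `^ gamma / gamma)))).
  by rewrite ler_pM2l.
rewrite (_ : _ * _ = C * L * (tau `^ gamma / gamma) * sup A); last by ring.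
by rewrite ler_wpM2r.
Qed.
End uniqueness.

(** * Smooth bumps *)

Section bump.
Context {R : realType}.
Local Notation mu := (@lebesgue_measure R).

(** The factors x^-n close the family under differentiation, see [is_derive_flat]. *)
Definition flat (n : nat) (x : R) : R := if 0 < x then x ^- n * expR (- x^-1) else 0.

Lemma flat_ge0 n x : 0 <= flat n x.
Proof.
rewrite /flat; case: ifP => // x0.
by rewrite mulr_ge0 ?expR_ge0 // invr_ge0 exprn_ge0 // ltW.
Qed.

Lemma flat_gt0 n x : 0 < x -> 0 < flat n x.
Proof. by move=> x0; rewrite /flat x0 mulr_gt0 ?expR_gt0 // invr_gt0 exprn_gt0. Qed.

Lemma flat_le0 n x : x <= 0 -> flat n x = 0.
Proof. by move=> x0; rewrite /flat ltNge x0. Qed.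

(** This is exp z >= z^n / n! at z = 1 / x. *)
Lemma flat_le_fact n x : flat n x <= n`!%:R.
Proof.
rewrite /flat; case: ifP => // x0.
rewrite expRN ler_pdivrMr ?expR_gt0 //.
case: n => [|n].
  rewrite expr0 invr1 fact0 mul1r; apply: le_trans (expR_ge1Dx _).
  by rewrite lerDl invr_ge0 ltW.
have h := @expR_ge1Dxn R x^-1 n; rewrite invr_ge0 (ltW x0) in h.
have {}h := h isT.
rewrite -ler_pdivrMl ?ltr0n ?fact_gt0 // mulrC -exprVn.
by apply: le_trans h; rewrite lerDr.
Qed.

Lemma flat_le_mul n k x : 0 < x -> flat n x <= x ^+ k * (n + k)`!%:R.
Proof.
move=> x0; apply: (@le_trans _ _ (x ^+ k * flat (n + k) x)).
  rewrite /flat x0 exprD mulrA ler_pM2r ?expR_gt0 //.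
  by rewrite invfM mulrCA mulfV ?mulr1 // expf_neq0 // gt_eqF.
by rewrite ler_wpM2l ?flat_le_fact // exprn_ge0 // ltW.
Qed.

Definition flat_deriv (n : nat) (x : R) : R := flat n.+2 x - n%:R * flat n.+1 x.

Lemma flat_deriv0 n : flat_deriv n 0 = 0.
Proof. by rewrite /flat_deriv !flat_le0 // mulr0 subrr. Qed.

Lemma flat_le_sqr n (h : R) : `|flat n h| <= h ^+ 2 * (n + 2)`!%:R.
Proof.
rewrite ger0_norm ?flat_ge0 //; have [h0|h0] := ltP 0 h; first exact: flat_le_mul.
by rewrite flat_le0 // mulr_ge0 // sqr_ge0.
Qed.

Lemma is_derive_flat (n : nat) (x : R) : is_derive x 1 (flat n) (flat_deriv n x).
Proof.
have [x0|x0|->] := ltgtP x 0.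
- have nz : \near x, cst 0 x = flat n x.
    by near=> z; rewrite flat_le0 //; apply: ltW; near: z; exact: lt_nbhsl.
  rewrite /flat_deriv !flat_le0 ?mulr0 ?subr0; [|exact: ltW..].
  by apply: (near_eq_is_derive nz).
- have nz : \near x, (fun z : R => (z^-1) ^+ n * expR (- z^-1)) x = flat n x.
    near=> z; have z0 : 0 < z by near: z; exact: lt_nbhsr.
    by rewrite /flat z0 exprVn.
  apply: (near_eq_is_derive nz).
  have xn0 : x != 0 by rewrite gt_eqF.
  have dV := is_deriveV (f := id) xn0 (is_derive_id x 1).
  have dX := is_deriveX n dV.
  have dE := @is_derive1_comp R expR (fun z => - z^-1) x _ _ (is_derive_expR _) (is_deriveN dV).
  have dM := is_deriveM dX dE.
  have fE : [eta GRing.inv] ^+ n * (expR \o (fun z : R => - z^-1)) =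
      (fun z : R => z^-1 ^+ n * expR (- z^-1)).
    apply/funext => z; rewrite /GRing.mul /=; congr (_ * _).
    by elim: n {nz dX dM} => [|n IH]; rewrite ?expr0 ?exprS // -IH.
  rewrite fE in dM; apply: (is_derive_eq dM).
  have iE : ([eta GRing.inv] ^+ n : R -> R) x = x ^- n by rewrite exprfctE exprVn.
  rewrite iE /flat_deriv /flat x0 /GRing.scale /= mulr1 exprVn.
  case: n {nz dX dM fE iE} => [|n] /=; first by rewrite !mul0r mulr0 !expr0 !exprS expr0; field.
  rewrite !exprS expr0; set w := x ^+ n.
  have w0 : w != 0 by rewrite expf_neq0.
  by field; rewrite w0.
- rewrite flat_deriv0.
  have lim : h^-1 *: (flat n (h *: 1 + 0) - flat n 0) @[h --> 0^'] --> (0 : R).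
    apply/cvgrPdist_le => e e0.
    pose K : R := (n + 2)`!%:R.
    have K0 : 0 < K by rewrite ltr0n fact_gt0.
    near=> h.
    have hn0 : h != 0 by near: h; exact: nbhs_dnbhs_neq.
    have he : `|h| <= e / K.
      near: h; apply: dnbhs0_le; exact: divr_gt0.
    rewrite sub0r normrN /GRing.scale /= mulr1 addr0 (flat_le0 n 0) // subr0 normrM normfV.
    rewrite ler_pdivrMl ?normr_gt0 //; apply: le_trans (flat_le_sqr n h) _.
    rewrite -/K -real_normK ?num_real // expr2 -mulrA ler_wpM2l //.
    by rewrite -ler_pdivlMr.
  by split; [exact: (cvgP _ lim)|exact: (cvg_lim _ lim)].
Unshelve. all: by end_near.
Qed.

Section bump_class.
Variables (p q : R).

(** By the product rule this class is stable under differentiation, so that its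
    members are smooth. *)
Inductive bump_class : (R -> R) -> Prop :=
| bump_prod m n : bump_class (fun x => flat m (x - p) * flat n (q - x))
| bump_add f h : bump_class f -> bump_class h -> bump_class (f + h)
| bump_scale (c : R) f : bump_class f -> bump_class (c *: f).

Lemma is_derive_flat_subr (n : nat) (x : R) :
  is_derive x 1 (fun x => flat n (x - p)) (flat_deriv n (x - p)).
Proof.
have h := @is_derive1_comp R (flat n) (fun z => z - p) x _ _ (is_derive_flat n (x - p))
  (is_deriveB (is_derive_id x 1) (is_derive_cst p x 1)).
by apply: (is_derive_eq h); rewrite subr0 mulr1.
Qed.

Lemma is_derive_flat_subl (n : nat) (x : R) :
  is_derive x 1 (fun x => flat n (q - x)) (- flat_deriv n (q - x)).
Proof.
have h := @is_derive1_comp R (flat n) (fun z => q - z) x _ _ (is_derive_flat n (q - x))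
  (is_deriveB (is_derive_cst q x 1) (is_derive_id x 1)).
by apply: (is_derive_eq h); rewrite sub0r mulrN1.
Qed.

Lemma bump_class_deriv f : bump_class f ->
  exists2 f', bump_class f' & forall x : R, is_derive x 1 f (f' x).
Proof.
elim=> [m n|f1 f2 _ [f1' c1 d1] _ [f2' c2 d2]|c f1 _ [f1' c1 d1]].
- pose P i j : R -> R := fun x => flat i (x - p) * flat j (q - x).
  (* The product rule, with the derivatives of [is_derive_flat]. *)
  exists (P m.+2 n + (- m%:R) *: P m.+1 n + (- 1) *: (P m n.+2) + n%:R *: P m n.+1).
    by do ![apply: bump_add|apply: bump_scale|apply: bump_prod].
  move=> x; have h := is_deriveM (is_derive_flat_subr m x) (is_derive_flat_subl n x).
  apply: (is_derive_eq h).
  rewrite !fctE /P /flat_deriv /GRing.scale /=; ring.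
- by exists (f1' + f2'); [exact: bump_add|move=> x; exact: is_deriveD].
- by exists (c *: f1'); [exact: bump_scale|move=> x; exact: is_deriveZ].
Qed.

Lemma bump_class_derive1 f : bump_class f -> bump_class (derive1 f).
Proof.
move=> /bump_class_deriv[f' cf' df]; suff -> : derive1 f = f' by [].
by apply/funext => x; rewrite derive1E; have [_ ->] := df x.
Qed.

Lemma bump_class_derivable f : bump_class f -> forall x : R, derivable f x 1.
Proof. by move=> /bump_class_deriv[f' _ df] x; have [] := df x. Qed.

Lemma bump_class_smooth f : bump_class f ->
  forall (n : nat) (x : R), derivable (derive1n n f) x 1.
Proof.
move=> cf n; suff : bump_class (derive1n n f) by exact: bump_class_derivable.
by elim: n => [//|n IH]; rewrite derive1nS; exact: bump_class_derive1.
Qed.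

Lemma bump_class_bounded f : bump_class f -> exists M : R, forall x : R, `|f x| <= M.
Proof.
elim=> [m n|f1 f2 _ [M1 h1] _ [M2 h2]|c f1 _ [M1 h1]].
- exists (m`!%:R * n`!%:R) => x; rewrite normrM.
  by apply: ler_pM => //; rewrite ger0_norm ?flat_ge0 ?flat_le_fact.
- by exists (M1 + M2) => x; apply: le_trans (ler_normD _ _) _; exact: lerD.
- by exists (`|c| * M1) => x; rewrite /GRing.scale /= normrM ler_wpM2l.
Qed.

Lemma bump_class_out f : bump_class f -> forall x : R, ~~ (p < x < q) -> f x = 0.
Proof.
move=> cf x; rewrite negb_and -!leNgt => xpq.
elim: cf => [m n|f1 f2 _ h1 _ h2|c f1 _ h1].
- case/orP: xpq => h; first by rewrite (flat_le0 m) ?mul0r // subr_le0.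
  by rewrite (flat_le0 n) ?mulr0 // subr_le0.
- by rewrite !fctE h1 h2 addr0.
- by rewrite !fctE h1 scaler0.
Qed.

Lemma bump_class_continuous f : bump_class f -> continuous f.
Proof.
by move=> cf x; apply/differentiable_continuous/derivable1_diffP/bump_class_derivable.
Qed.

Lemma bump_class_measurable f : bump_class f -> measurable_fun setT f.
Proof. by move=> cf; apply: continuous_measurable_fun; exact: bump_class_continuous. Qed.

Lemma bump_class_integrable f : bump_class f -> mu.-integrable setT (EFin \o f).
Proof.
move=> cf; have [M fM] := bump_class_bounded f cf.
have i1 : mu.-integrable setT (EFin \o \1_(`]p, q[%classic)) by exact: integrable_indic_itv.
have := integrable_bounded_mul _ _ M i1 (bump_class_measurable f cf) fM.
apply: eq_integrable => // x _ /=.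
rewrite indicE; congr EFin; case: (boolP (x \in _)) => [|/negP xo]; rewrite ?mul1r //= mul0r.
rewrite (bump_class_out _ cf) //; apply/negP => xpq; apply: xo; apply/mem_set.
by rewrite /= in_itv.
Qed.

Definition bump (x : R) : R := flat 0 (x - p) * flat 0 (q - x).

Lemma bump_in_class : bump_class bump. Proof. exact: bump_prod. Qed.

Lemma bump_ge0 x : 0 <= bump x.
Proof. by rewrite mulr_ge0 // flat_ge0. Qed.

Lemma bump_test (T : R) : q < T -> test_function T bump.
Proof.
move=> qT.
have sub : closure [set x | bump x != 0] `<=` `[p, q]%classic.
  have /closure_id -> : closed `[p, q]%classic by exact: interval_closed.
  apply: closureS => x /= bx; rewrite in_itv/=; apply/negPn/negP => xpq.
  move: bx; rewrite (bump_class_out _ bump_in_class) ?eqxx //.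
  by apply: contra xpq => /andP[/ltW-> /ltW->].
split.
- exact: bump_class_smooth bump_in_class.
- apply: (subclosed_compact _ _ sub); first exact: closed_closure.
  exact: segment_compact.
- move=> x /sub /=; rewrite !in_itv/= => /andP[_ xq].
  exact: le_lt_trans qT.
Qed.
End bump_class.

Lemma bump_shift (p q s x : R) : bump p q (x + s) = bump (p - s) (q - s) x.
Proof.
rewrite /bump (_ : x + s - p = x - (p - s)); last by ring.
by rewrite (_ : q - (x + s) = q - s - x) //; ring.
Qed.

Lemma derive1_bump_shift (p q s x : R) :
  derive1 (bump p q) (x + s) = derive1 (bump (p - s) (q - s)) x.
Proof.
have -> : bump (p - s) (q - s) = bump p q \o (fun z => z + s).
  by apply/funext => z; rewrite /= bump_shift.
have [f' _ df] := bump_class_deriv _ _ _ (bump_in_class p q).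
have h := @is_derive1_comp R (bump p q) (fun z => z + s) x _ _ (df (x + s))
  (is_deriveD (is_derive_id x 1) (is_derive_cst s x 1)).
rewrite !derive1E; have [_ ->] := h; have [_ ->] := df (x + s).
by rewrite addr0 mulr1.
Qed.
End bump.

(** * From the weak equation to an orthogonality relation *)

Section weak_to_volterra.
Context {R : realType}.
Local Notation mu := (@lebesgue_measure R).
Variables (gamma S : R).
Hypotheses (g01 : 0 < gamma < 1) (S0 : 0 < S).
Local Notation g := (ker (gamma - 1) S).
Local Notation k := (ker (- gamma) S).
Local Notation B := (beta (gamma - 1) (- gamma)).

(** The equation for the Caputo derivative tested against bumps, with G in the place
    of 1 / Gamma(1 - gamma).  The bumps may reach below 0: translating one to the left
    gives another one. *)
Definition weak_solution (G : R) (y F : R -> R) := forall p q : R, q < S ->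
  - (G * \int[mu]_s (k s * \int[mu]_t (y t * derive1 (bump p q) (t + s)))) =
  \int[mu]_t (F t * bump p q t).

Lemma integral_derive1_bump (p q t : R) : q < S -> 0 <= t ->
  \int[mu]_x (\1_(`]0, S[%classic) x * derive1 (bump p q) (t + x)) = - bump p q t.
Proof.
move=> qS t0.
have cb := bump_in_class p q.
have cb' := bump_class_derive1 _ _ _ cb.
have cd : continuous (fun x : R => derive1 (bump p q) (t + x)).
  move=> x; apply: (@continuous_comp _ _ _ (fun x => t + x) (derive1 (bump p q))).
    by apply: cvgD; [exact: cvg_cst|exact: cvg_id].
  exact: (bump_class_continuous _ _ _ cb').
have cF : continuous (fun x : R => bump p q (t + x)).
  move=> x; apply: (@continuous_comp _ _ _ (fun x => t + x) (bump p q)).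
    by apply: cvgD; [exact: cvg_cst|exact: cvg_id].
  exact: (bump_class_continuous _ _ _ cb).
have D (x : R) : is_derive x 1 (fun x : R => bump p q (t + x)) (derive1 (bump p q) (t + x)).
  have [f' _ df] := bump_class_deriv _ _ _ cb.
  have h := @is_derive1_comp R (bump p q) (fun z => t + z) x _ _ (df (t + x))
    (is_deriveD (is_derive_cst t x 1) (is_derive_id x 1)).
  apply: (is_derive_eq h).
  by rewrite add0r mulr1 derive1E; have [_ ->] := df (t + x).
transitivity (\int[mu]_(x in `[0, S]) derive1 (bump p q) (t + x)).
  rewrite /Rintegral [in RHS]integral_itv_bndoo; last first.
    by apply/measurable_EFinP; apply: measurable_funTS; exact: continuous_measurable_fun.
  rewrite [in RHS]integral_mkcond; congr fine; apply: eq_integral => x _.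
  by rewrite /patch indicE; case: (x \in _); rewrite ?mul1r ?mul0r.
rewrite /Rintegral (continuous_FTC2 (F := fun x => bump p q (t + x))) //=.
- rewrite addr0 (bump_class_out _ _ _ cb (t + S)) ?sub0r //.
  by rewrite negb_and -!leNgt; apply/orP; right; lra.
- exact: continuous_subspaceT.
- split.
  + by move=> x _; have [] := D x.
  + by apply: cvg_at_right_filter; exact: cF.
  + by apply: cvg_at_left_filter; exact: cF.
- by move=> x _; rewrite derive1E; have [_ ->] := D x.
Qed.

Lemma integrable_bounded_support (M : R) (h : R -> R) : measurable_fun setT h ->
  (forall x : R, `|h x| <= M) -> (forall x : R, ~~ (0 <= x <= S) -> h x = 0) ->
  mu.-integrable setT (EFin \o h).
Proof.
move=> mh hM hout.
have i1 : mu.-integrable setT (EFin \o \1_(`[0, S]%classic)) by exact: integrable_indic_itv.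
have := integrable_bounded_mul _ h M i1 mh hM.
rewrite (_ : (fun x => _) = h) //; apply/funext => x; rewrite indicE.
case: (boolP (x \in _)) => [|/negP xS]; first by rewrite mul1r.
rewrite mul0r hout //; apply/negP => h0; apply: xS; apply/mem_set.
by rewrite /= in_itv.
Qed.

(** Integrating the weak identity over the left translates of a bump, with weight g,
    replaces k by g * k, which is the constant B on (0, S).  On the left side the
    derivative of the bump is then integrated back to the bump itself. *)
Lemma weak_bump_orthogonal (G M : R) (y F : R -> R) :
  weak_solution G y F ->
  measurable_fun setT y -> measurable_fun setT F ->
  (forall x : R, `|y x| <= M) -> (forall x : R, `|F x| <= M) ->
  (forall x : R, ~~ (0 <= x <= S) -> y x = 0) -> (forall x : R, ~~ (0 <= x <= S) -> F x = 0) ->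
  forall p q, q < S ->
  \int[mu]_t (bump p q t * (G * B * y t)) = \int[mu]_t (bump p q t * conv g F t).
Proof.
move=> weak my mF yM FM yout Fout p q qS.
have /andP[gam0 gam1] := g01.
have gm : -1 < - gamma by lra.
have ig := @integrable_abel_kernel _ gamma S g01.
have ik := integrable_ker (- gamma) S gm.
have M0 : 0 <= M := le_trans (normr_ge0 _) (yM 0).
have cb := bump_in_class p q.
have cb' := bump_class_derive1 _ _ _ cb.
have i1o : mu.-integrable setT (EFin \o \1_(`]0, S[%classic)) by exact: integrable_indic_itv.
have yneg t : t < 0 -> y t = 0.
  by move=> t0; apply: yout; rewrite negb_and -ltNge t0.
have iy := integrable_bounded_support M y my yM yout.
have iF := integrable_bounded_support M F mF FM Fout.
have [Mc hMc] := bump_class_bounded _ _ _ cb.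
have [Md hMd] := bump_class_bounded _ _ _ cb'.
have mc := bump_class_measurable _ _ _ cb.
have md := bump_class_measurable _ _ _ cb'.
pose Lam x := \int[mu]_t (y t * derive1 (bump p q) (t + x)).
have LamD x : Lam x = \int[mu]_t (y t * derive1 (bump p q) (t + x)) by [].
have LamE : Lam = conv (fun t => y (- t)) (derive1 (bump p q)).
  apply/funext => x; rewrite LamD /conv -[LHS]Rintegral_opp.
    by apply: eq_Rintegral => t _; rewrite (addrC x).
  apply: measurable_funM => //; apply: (measurableT_comp md).
  exact: measurable_funD.
clearbody Lam.
have iyN : mu.-integrable setT (EFin \o (fun t => y (- t))).
  by have := integrable_reflect 0 _ iy; under eq_fun do rewrite sub0r.
have mL : measurable_fun setT Lam.
  by rewrite LamE; apply: (measurable_conv _ _ Md).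
have LM x : `|Lam x| <= (\int[mu]_t `|y (- t)|) * Md.
  by rewrite LamE; apply: conv_bounded.
have Lout x : S <= x -> Lam x = 0.
  clear LamE mL LM; move=> Sx; rewrite LamD; apply: Rintegral_eq0 => t.
  have [t0|t0] := ltP t 0; first by rewrite (yneg _ t0) mul0r.
  rewrite (bump_class_out _ _ _ cb' (t + x)) ?mulr0 //.
  by rewrite negb_and -!leNgt; apply/orP; right; lra.
clear LamE.
have ikN : mu.-integrable setT (EFin \o (fun s => k (- s))).
  by have := integrable_reflect 0 _ ik; under eq_fun do rewrite sub0r.
(* For t > 0, bump p q (_ + t) is the bump of p - t and q - t, whose support also
   ends before S. *)
transitivity (\int[mu]_t (g t * \int[mu]_s (F s * bump p q (s + t)))); last first.
  exact: (conv_swap _ _ _ Mc).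
transitivity (- G * \int[mu]_t (g t * \int[mu]_s (k s * Lam (s + t)))); last first.
  rewrite -RintegralZl_measurable; last first.
    apply: measurable_funM; first exact: measurable_ker.
    rewrite (_ : (fun t => _) = conv (fun s => k (- s)) Lam); first exact: (measurable_conv _ _ _ ikN mL LM).
    apply/funext => t; rewrite /conv -[LHS]Rintegral_opp.
      by apply: eq_Rintegral => s _; rewrite (addrC t).
    apply: measurable_funM; first exact: measurable_ker.
    by apply: (measurableT_comp mL); exact: measurable_funD.
  apply: eq_Rintegral => t _.
  have [t0|t0] := leP t 0; first by rewrite (ker_le0 _ _ _ t0) !mul0r mulr0.
  have := weak (p - t) (q - t) (ltac:(lra)).
  under [X in _ = X -> _]eq_Rintegral do rewrite -bump_shift.
  move=> <-; rewrite mulrCA; congr (_ * _); rewrite mulNr; congr (- (_ * _)).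
  apply: eq_Rintegral => s _; congr (_ * _); rewrite LamD; apply: eq_Rintegral => r _.
  by rewrite -derive1_bump_shift addrA.
rewrite (conv_swap _ _ _ _ ig ik mL LM).
have -> : \int[mu]_x (Lam x * conv g k x) =
    B * \int[mu]_x (\1_(`]0, S[%classic) x * Lam x).
  rewrite -RintegralZl_measurable; last by apply: measurable_funM.
  apply: eq_Rintegral => x _; rewrite indicE.
  have [x0|x0] := leP x 0.
    rewrite conv_le0 // => [|z z0]; last by rewrite ker_le0 // ltW.
    by rewrite memNset ?mul0r ?mulr0 //= in_itv/= ltNge x0.
  have [Sx|xS] := leP S x; first by rewrite Lout // mul0r !mulr0.
  rewrite conv_ker ?(ltW xS) //; last by lra.
  by rewrite mem_set /= ?in_itv/= ?x0 // mul1r mulrC.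
have -> : \int[mu]_x (\1_(`]0, S[%classic) x * Lam x) = \int[mu]_t (y t * - bump p q t).
  have mh : measurable_fun setT (fun z : R * R => derive1 (bump p q) (z.2 + z.1)).
    by apply: (measurable_comp_prod (derive1 (bump p q))) => //; exact: measurable_add_prod.
  have sw := Rintegral_swap_bounded _ _ (fun z => derive1 (bump p q) (z.2 + z.1)) Md i1o iy mh
    (fun z => hMd (z.2 + z.1)).
  under eq_Rintegral => x _ do rewrite LamD.
  rewrite [LHS]sw; apply: eq_Rintegral => t _.
  have [/andP[t0 tS]|tout] := boolP (0 <= t <= S); last by rewrite (yout _ tout) !mul0r.
  by rewrite /= integral_derive1_bump.
rewrite mulrA -(RintegralZl_measurable (- G * B) (fun t => y t * - bump p q t)); last first.
  by apply: measurable_funM => //; exact: (measurable_funN mc).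
by apply: eq_Rintegral => t _; ring.
Qed.

Lemma integral_bump_gt0 (p q : R) : p < q -> 0 < \int[mu]_t bump p q t.
Proof.
move=> pq; pose d := (q - p) / 3.
have d0 : 0 < d by rewrite divr_gt0 // subr_gt0.
have fd := flat_gt0 0 d d0.
have flat_mono z : d <= z -> flat 0 d <= flat 0 z.
  move=> dz; have z0 : 0 < z by lra.
  by rewrite /flat d0 z0 !expr0 !invr1 !mul1r ler_expR lerN2 lef_pV2.
apply: (@lt_le_trans _ _ (\int[mu]_(t in `]p + d, q - d[) (flat 0 d * flat 0 d))).
  have pqd : p + d < q - d by rewrite /d; lra.
  rewrite Rintegral_cst //= lebesgue_measure_itv /= lte_fin pqd /=.
  by rewrite !mulr_gt0 // subr_gt0.
have cb := bump_in_class p q.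
rewrite Rintegral_mkcond; apply: le_Rintegral => //.
- rewrite -restrict_EFin; apply/integrable_restrict => //; rewrite setTI.
  apply: measurable_bounded_integrable => //=.
  + by rewrite lebesgue_measure_itv /=; case: ifP => _; rewrite ?ltry // -EFinB ltry.
  + exact: bounded_cst.
- exact: (bump_class_integrable _ _ _ cb).
- move=> t _; rewrite patchE; case: ifPn => [/set_mem /=|_]; last exact: bump_ge0.
  rewrite in_itv/= => /andP[t1 t2]; apply: ler_pM; rewrite ?flat_ge0 //; apply: flat_mono; lra.
Qed.

(** If Q1 exceeded Q2 at x, a bump supported close to x would separate them.  Equality
    follows by exchanging Q1 and Q2. *)
Lemma continuous_orthogonal_bump (Q1 Q2 : R -> R) (M : R) :
  measurable_fun setT Q1 -> measurable_fun setT Q2 ->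
  (forall x, `|Q1 x| <= M) -> (forall x, `|Q2 x| <= M) ->
  (forall p q, q < S -> \int[mu]_t (bump p q t * Q1 t) = \int[mu]_t (bump p q t * Q2 t)) ->
  forall x, 0 < x < S -> {for x, continuous Q1} -> {for x, continuous Q2} -> Q1 x <= Q2 x.
Proof.
move=> m1 m2 h1 h2 eqb x /andP[x0 xS] c1 c2; rewrite leNgt; apply/negP => Q12.
pose Q z := Q1 z - Q2 z.
have cQ : {for x, continuous Q} by exact: cvgB.
have Qx : 0 < Q x by rewrite subr_gt0.
pose m := Q x / 2.
have m0 : 0 < m by rewrite divr_gt0.
have mQ : m < Q x by rewrite /m; lra.
have /cvgr_gt := cQ => /(_ _ mQ) [e /= e0 he].
pose d := Num.min (e / 2) ((S - x) / 2).
have d0 : 0 < d by rewrite lt_min !divr_gt0 // subr_gt0.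
have [de dS] : d <= e / 2 /\ d <= (S - x) / 2 by rewrite /d !ge_min !lexx orbT.
have qS : x + d < S by lra.
have pq : x - d < x + d by lra.
have cb := bump_in_class (x - d) (x + d).
have ib := bump_class_integrable _ _ _ cb.
have ib1 := integrable_bounded_mul _ _ M ib m1 h1.
have ib2 := integrable_bounded_mul _ _ M ib m2 h2.
have := eqb (x - d) (x + d) qS; apply/eqP; rewrite gt_eqF // -subr_gt0 -RintegralB //.
apply: (@lt_le_trans _ _ (m * \int[mu]_t bump (x - d) (x + d) t)).
  by rewrite mulr_gt0 // integral_bump_gt0.
rewrite -RintegralZl //; apply: le_Rintegral => //.
- have := integrableZl measurableT m ib.
  by apply: eq_integrable => // t _ /=; rewrite -EFinM.
- have := integrableB measurableT ib1 ib2.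
  by apply: eq_integrable => // t _ /=; rewrite -EFinB.
- move=> t _; rewrite -mulrBr -/(Q t).
  have [/andP[t1 t2]|out] := boolP (x - d < t < x + d); last first.
    by rewrite (bump_class_out _ _ _ cb _ out) mulr0 mul0r.
  rewrite mulrC ler_wpM2l ?bump_ge0 //; apply/ltW/he.
  by rewrite /ball_ /= ltr_norml; apply/andP; split; lra.
Qed.
End weak_to_volterra.

(** * Continuity of Abel integrals *)

Section continuity_conv.
Context {R : realType}.
Local Notation mu := (@lebesgue_measure R).
Variables (gamma S : R).
Hypotheses (g01 : 0 < gamma < 1) (S0 : 0 < S).
Local Notation g := (ker (gamma - 1) S).

Lemma Rintegral_eq_except (x : R) (f h : R -> R) :
  measurable_fun setT f -> measurable_fun setT h ->
  (forall t, t != x -> f t = h t) -> \int[mu]_t f t = \int[mu]_t h t.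
Proof.
move=> mf mh fh; rewrite /Rintegral; congr fine.
have mx : measurable ([set: R] `\ x) by apply: measurableD => //; exact: measurable_set1.
rewrite -[LHS](@integral_setD1 R _ x setT mx); last first.
  by apply: measurable_funTS; exact/measurable_EFinP.
rewrite -[RHS](@integral_setD1 R _ x setT mx); last first.
  by apply: measurable_funTS; exact/measurable_EFinP.
apply: eq_integral => t /set_mem [_ /= /eqP tx].
by rewrite fh.
Qed.

Lemma continuous_conv_ker (F : R -> R) (M : R) :
  measurable_fun setT F -> (forall x : R, `|F x| <= M) ->
  (forall x, x < S -> {for x, continuous F}) ->
  forall x, 0 < x < S -> {for x, continuous (conv g F)}.
Proof.
move=> mF FM cF x xS.
have ig := @integrable_abel_kernel _ gamma S g01.
have h := @continuity_under_integral R _ _ mu (fun l t => g t * F (l - t)) setT measurableT 0 S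
  _ _ (fun t => `|g t| * M) _ _ x.
apply: h.
- by move=> l _; exact: (integrable_conv_integrand _ _ M ig mF FM).
- apply: aeW => t _ l /set_mem /=; rewrite in_itv/= => /andP[l0 lS].
  have [t0|t0] := leP t 0.
    rewrite (_ : (fun l => _) = cst 0); first exact: cst_continuous.
    by apply/funext => z; rewrite ker_le0 // mul0r.
  apply: cvgMl_tmp.
  apply: (@continuous_comp _ _ _ (fun z => z - t) F).
    by apply: cvgB; [exact: cvg_id|exact: cvg_cst].
  by apply: cF; lra.
- have := integrableZl measurableT M (integrable_norm ig).
  by apply: eq_integrable => // t _ /=; rewrite -EFinM mulrC.
- move=> l _; apply: aeW => t _.
  by rewrite normrM ler_wpM2l.
- by apply/mem_set; rewrite /= in_itv.
Qed.

(** The integrand is g t for t > x and 0 otherwise; it differs from the difference of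
    the powers truncated at S and at x only at t = x. *)
Lemma conv_step (x : R) : 0 < x < S ->
  conv g (fun z => if z < 0 then 1 else 0) x = S `^ gamma / gamma - x `^ gamma / gamma.
Proof.
move=> /andP[x0 xS]; have /andP[gam0 gam1] := g01.
have gm : -1 < gamma - 1 by lra.
have mneg : measurable_fun setT (fun z : R => if x - z < 0 then 1 else 0 : R).
  apply: measurable_fun_ifT => //.
  by apply: measurable_fun_ltr => //; exact: measurable_funB.
rewrite -!Rintegral_ker // -RintegralB //; try exact: integrable_ker.
apply: (Rintegral_eq_except x).
- by apply: measurable_funM => //; exact: measurable_ker.
- by apply: measurable_funB; exact: measurable_ker.
- move=> t tx; rewrite subr_lt0.
  have [xt|xt] := ltP x t.
    by rewrite mulr1 (_ : ker _ x t = 0) ?subr0 // /ker [t < x]ltNge (ltW xt) andbF.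
  rewrite mulr0; have {}xt : t < x by rewrite lt_neqAle tx.
  by rewrite (kerS _ x S t xt (ltW xS)) subrr.
Qed.

(** F may jump at 0.  Extending it to the left by the constant F 0 removes the jump
    and changes the convolution by a multiple of the explicit function of
    [conv_step]. *)
Lemma continuous_conv_ker_jump (F : R -> R) (M : R) :
  measurable_fun setT F -> (forall x : R, `|F x| <= M) -> (forall x, x < 0 -> F x = 0) ->
  (forall x, x < S -> {for x, continuous (fun z : R => F (Num.max z 0))}) ->
  forall x, 0 < x < S -> {for x, continuous (conv g F)}.
Proof.
move=> mF FM F0 cF x xS; have ig := @integrable_abel_kernel _ gamma S g01.
have /andP[gam0 gam1] := g01.
pose Ft (z : R) := F (Num.max z 0).
have mFt : measurable_fun setT Ft.
  by apply: (measurableT_comp mF); exact: measurable_maxr.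
have FtM z : `|Ft z| <= M by exact: FM.
pose H (z : R) : R := if z < 0 then 1 else 0.
have mH : measurable_fun setT H.
  by apply: measurable_fun_ifT => //; exact: measurable_fun_ltr.
have H1 z : `|H z| <= 1 by rewrite /H; case: ifP; rewrite ?normr1 ?normr0.
have FE z : F z = Ft z - F 0 * H z.
  rewrite /Ft /H; case: ltP => [z0|z0].
    by rewrite F0 // mulr1 subrr.
  by rewrite mulr0 subr0.
have convE z : conv g F z = conv g Ft z - F 0 * conv g H z.
  have i1 := integrable_conv_integrand _ _ M ig mFt FtM z.
  have i2 := integrable_conv_integrand _ _ 1 ig mH H1 z.
  rewrite /conv -RintegralZl // -RintegralB //.
    by apply: eq_Rintegral => t _; rewrite FE; ring.
  have := integrableZl measurableT (F 0) i2.
  by apply: eq_integrable => // t _ /=; rewrite -EFinM.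
pose K z := conv g Ft z - F 0 * (S `^ gamma / gamma - z `^ gamma / gamma).
have KE : \near x, K x = conv g F x.
  have xin : x \in `]0, S[ by rewrite in_itv.
  near=> z; rewrite /K convE conv_step //.
  suff : z \in `]0, S[ by rewrite in_itv.
  by near: z; exact: near_in_itvoo.
have cK : {for x, continuous K}.
  apply: cvgB; first exact: (continuous_conv_ker _ M).
  apply: cvgMl_tmp; apply: cvgB; first exact: cvg_cst.
  apply: cvgMr_tmp; apply: continuous_powR.
  by case/andP: xS.
have Kx : K x = conv g F x := nbhs_singleton KE.
rewrite /prop_for /continuous_at -Kx.
exact: (cvg_trans (near_eq_cvg KE) cK).
Unshelve. all: by end_near. Qed.
End continuity_conv.

(** * The gamma integral and the initial value *)

Section gamma_function.
Context {R : realType}.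
Local Notation mu := (@lebesgue_measure R).

Lemma integrable_expRN : mu.-integrable `[0, +oo[ (EFin \o (fun x : R => expR (- x))).
Proof.
apply/integrableP; split.
  apply/measurable_EFinP; apply: measurable_funTS.
  by apply: (measurableT_comp (@measurable_expR R)); exact: measurable_funN.
under eq_integral do rewrite /= ger0_norm ?expR_ge0 //.
have cE : continuous (fun x : R => expR (- x)).
  move=> x; apply: (@continuous_comp _ _ _ -%R (@expR R)); last exact: continuous_expR.
  by apply: cvgN; exact: cvg_id.
have dE (x : R) : is_derive x 1 (fun x : R => - expR (- x)) (expR (- x)).
  have h := is_deriveN (@is_derive1_comp R expR -%R x _ _ (is_derive_expR _) (is_deriveNid x 1)).
  by apply: (is_derive_eq h); rewrite mulrN1 opprK.
rewrite (@ge0_continuous_FTC2y R _ (fun x => - expR (- x)) 0 0) ?ltry //.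
- exact: continuous_subspaceT.
- by rewrite -[X in _ --> X]oppr0; apply: cvgN; exact: cvgr_expR.
- by apply: cvg_at_right_filter; apply: cvgN; exact: cE.
- by move=> x _; rewrite derive1E; have [_ ->] := dE x.
Qed.

(** The power dominates the integrand near 0 and the exponential dominates it at
    infinity, so the integral is finite.  The integrand is at least exp(-1) on (0, 1). *)
Lemma Gamma_gt0 (a : R) : 0 < a -> a < 1 -> 0 < Gamma a.
Proof.
move=> a0 a1; rewrite /Gamma Rintegral_mkcond.
pose f := (fun x : R => x `^ (a - 1) * expR (- x)) \_ `]0, +oo[.
have mpe : measurable_fun setT (fun x : R => x `^ (a - 1) * expR (- x)).
  apply: measurable_funM; first exact: measurable_powR.
  by apply: (measurableT_comp (@measurable_expR R)); exact: measurable_funN.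
have mf : measurable_fun setT f.
  by apply/(measurable_restrictT _ _).1 => //; exact: measurable_funTS.
have fE (x : R) : 0 < x -> f x = x `^ (a - 1) * expR (- x).
  by move=> x0; rewrite /f patchE mem_set //= in_itv/= x0.
have fE0 (x : R) : x <= 0 -> f x = 0.
  by move=> x0; rewrite /f patchE memNset //= in_itv/= ltNge x0.
have ik : mu.-integrable setT (EFin \o ker (a - 1) 2) by apply: integrable_ker; lra.
pose E := (fun x : R => expR (- x)) \_ `[0, +oo[.
have iE : mu.-integrable setT (EFin \o E).
  rewrite /E -restrict_EFin; apply/integrable_restrict => //; rewrite setTI.
  exact: integrable_expRN.
have E0 (x : R) : 0 <= E x by rewrite /E patchE; case: ifP => // _; exact: expR_ge0.
have if_ : mu.-integrable setT (EFin \o f).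
  apply: (le_integrable measurableT _ _ (integrableD measurableT ik iE)).
    exact/measurable_EFinP.
  move=> x _ /=; rewrite lee_fin !ger0_norm ?addr_ge0 ?ker_ge0 //; last first.
    have [x0|x0] := ltP 0 x; last by rewrite fE0.
    by rewrite fE // mulr_ge0 ?powR_ge0 ?expR_ge0.
  have [x0|x0] := ltP 0 x; last by rewrite fE0 // addr_ge0 // ker_ge0.
  rewrite fE //; have [x2|x2] := ltP x 1.
    rewrite -[leLHS]addr0; apply: lerD => //; rewrite ker_in //; last lra.
    by rewrite ler_piMr ?powR_ge0 // expR_le1 oppr_le0 ltW.
  rewrite -[leLHS]add0r; apply: lerD; first exact: ker_ge0.
  rewrite /E patchE mem_set /=; last by rewrite in_itv/= andbT ltW.
  rewrite ler_piMl ?expR_ge0 //.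
  have := @powR_le0_anti R (a - 1) 1 x (ltac:(lra)) ltr01 x2.
  by rewrite powR1.
apply: (@lt_le_trans _ _ (\int[mu]_(t in `]0, 1[) (expR (- 1) : R))).
  rewrite Rintegral_cst //= lebesgue_measure_itv /= lte_fin ltr01 /= subr0 mulr1.
  exact: expR_gt0.
rewrite Rintegral_mkcond; apply: le_Rintegral => //.
- rewrite -restrict_EFin; apply/integrable_restrict => //; rewrite setTI.
  apply: measurable_bounded_integrable => //=.
  + by rewrite lebesgue_measure_itv /= lte_fin ltr01 -EFinB ltry.
  + exact: bounded_cst.
- move=> t _; rewrite -/f patchE; case: ifPn => [/set_mem /=|_].
    rewrite in_itv/= => /andP[t0 t1]; rewrite fE // -[leLHS]mul1r.
    apply: ler_pM; rewrite ?expR_ge0 //.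
      have := @powR_le0_anti R (a - 1) t 1 (ltac:(lra)) t0 (ltW t1).
      by rewrite powR1.
    by rewrite ler_expR; lra.
  have [x0|x0] := ltP 0 t; last by rewrite fE0.
  by rewrite fE // mulr_ge0 ?powR_ge0 ?expR_ge0.
Qed.

(** If the two limits differed, |u - u0| would be bounded below near 0, and so would its
    averages. *)
Lemma right_limit_value (u : R -> R) (u0 l S : R) : 0 < S ->
  measurable_fun `]0, S[ u -> u x @[x --> 0^'+] --> l -> right_limit u u0 -> l = u0.
Proof.
move=> S0 mu_ ul rl; apply/eqP/negPn/negP => lu0.
pose d : R := `|l - u0| / 2.
have d0 : 0 < d by rewrite divr_gt0 // normr_gt0 subr_eq0.
have near_u : \forall s \near 0^'+, d <= `|u s - u0|.
  have h : `|u x - u0| @[x --> 0^'+] --> `|l - u0|.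
    by apply: cvg_norm; apply: cvgB => //; exact: cvg_cst.
  have dl : d < `|l - u0| by move: d0; rewrite /d; move: (`|l - u0|) => z; lra.
  exact: (cvgr_ge _ h _ dl).
have [e e0 he] : exists2 e : R, 0 < e & forall s, 0 < s < e -> d <= `|u s - u0|.
  have := near_u => -[e /= e0 he]; exists e => // s /andP[s0 se].
  by apply: he => //; rewrite /ball_ /= sub0r normrN ger0_norm // ltW.
pose A t := ((t^-1)%:E * \int[mu]_(s in `]0%R, t[) `|(u s - u0)%:E|)%E.
have /fine_cvgP[Afin Alim] : A t @[t --> 0^'+] --> 0%:E by exact: rl.
have Ad : \forall t \near 0^'+, fine (A t) < d.
  by have /cvgr_lt := Alim; apply.
have /filter_ex[t [t0 tm Atfin At]] : \forall t \near 0^'+,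
    [/\ 0 < t, t < Num.min e S, A t \is a fin_num & fine (A t) < d].
  near=> t; split.
  - by near: t; exact: nbhs_right_gt.
  - by near: t; apply: nbhs_right_lt; rewrite lt_min e0.
  - by near: t.
  - by near: t.
move: At; apply/negP; rewrite -leNgt -lee_fin fineK // /A.
move: tm; rewrite lt_min => /andP[te tS].
have mt : measurable_fun `]0, t[ (fun s => `|(u s - u0)%:E|%E).
  apply: measurableT_comp => //; apply/measurable_EFinP.
  apply: measurable_funB => //; apply: measurable_funS mu_ => //.
  by move=> s /=; rewrite !in_itv/= => /andP[-> st]; exact: lt_trans tS.
apply: (@le_trans _ _ ((t^-1)%:E * \int[mu]_(s in `]0%R, t[) d%:E)%E).
  rewrite integral_cst //= lebesgue_measure_itv /= lte_fin t0 -EFinB subr0 -!EFinM lee_fin.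
  by rewrite mulrCA mulVf ?mulr1 // gt_eqF.
apply: lee_wpmul2l; first by rewrite lee_fin invr_ge0 ltW.
apply: ge0_le_integral => //.
- by move=> s _; rewrite lee_fin ltW.
- move=> s /=; rewrite in_itv/= => /andP[s0 st]; rewrite lee_fin he // s0 /=.
  exact: lt_trans te.
Unshelve. all: by end_near. Qed.
End gamma_function.

(** * The Caputo equation tested against bumps *)

Section weak_of_strong.
Context {R : realType}.
Local Notation mu := (@lebesgue_measure R).
Variables (gamma S u0 : R) (f u : R -> R).
Hypotheses (g01 : 0 < gamma < 1) (S0 : 0 < S).
Local Notation k := (ker (- gamma) S).

(** Extension by 0 turns all integrals over [0, S] into integrals over the line of
    bounded functions. *)
Definition window (h : R -> R) (t : R) : R := if 0 <= t <= S then h t else 0.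

Local Notation y := (window (fun t => u t - u0)).
Local Notation F := (window (fun t => f (u t))).

Lemma window_out (h : R -> R) (t : R) : ~~ (0 <= t <= S) -> window h t = 0.
Proof. by rewrite /window => /negbTE ->. Qed.

Variable M : R.
Hypotheses (my : measurable_fun setT y) (mF : measurable_fun setT F)
  (yM : forall x : R, `|y x| <= M) (FM : forall x : R, `|F x| <= M).

(** The support of the bump ends before S, so for s > 0 only the values of u on
    [0, S] enter; then one differentiates under the integral. *)
Lemma derive1_pairing (p q s : R) : q < S -> 0 < s ->
  derive1 (fun s => \int[mu]_t ((u t - u0) * heaviside t * bump p q (s + t))) s =
  \int[mu]_t (y t * derive1 (bump p q) (t + s)).
Proof.
move=> qS s0.
have cb := bump_in_class p q.
have cb' := bump_class_derive1 _ _ _ cb.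
have [Mc hMc] := bump_class_bounded _ _ _ cb.
have [Md hMd] := bump_class_bounded _ _ _ cb'.
have mc := bump_class_measurable _ _ _ cb.
have iy := integrable_bounded_support S M y my yM (window_out _).
pose h (x t : R) := y t * bump p q (x + t).
have near_eq : \forall x \near s, \int[mu]_t ((u t - u0) * heaviside t * bump p q (x + t)) =
    \int[mu]_t h x t.
  near=> x; have x0 : 0 < x by near: x; exact: lt_nbhsr.
  apply: eq_Rintegral => t _; rewrite /h /window /heaviside.
  have [t0|t0] := leP 0 t; last by rewrite mulr0 !mul0r.
  have [tS|tS] := leP t S; first by rewrite mulr1.
  rewrite (bump_class_out _ _ _ cb (x + t)) ?mulr0 //.
  by rewrite negb_and -!leNgt; apply/orP; right; lra.
rewrite derive1E (near_eq_derive _ near_eq) -derive1E.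
have db (t x : R) : is_derive x 1 (fun x => h x t) (y t * derive1 (bump p q) (x + t)).
  have [f' _ df] := bump_class_deriv _ _ _ cb.
  have h1 := @is_derive1_comp R (bump p q) (fun z => z + t) x _ _ (df (x + t))
    (is_deriveD (is_derive_id x 1) (is_derive_cst t x 1)).
  have h2 := is_deriveZ (y t) h1.
  apply: (is_derive_eq h2).
  by rewrite addr0 mulr1 derive1E; have [_ ->] := df (x + t).
have hd (x t : R) : partial1of2 h x t = y t * derive1 (bump p q) (x + t).
  by rewrite /partial1of2 derive1E; have [_ ->] := db t x.
have sI : `]0, (s + 1)[%classic s by rewrite /= in_itv/= s0 ltrDl ltr01.
have := @differentiation_under_integral R _ _ mu h setT measurableT s 0 (s + 1) sI
  _ _ (fun t => `|y t| * Md) _ _ _.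
rewrite /= => ->.
- by apply: eq_Rintegral => t _; rewrite hd (addrC s).
- move=> x _; apply: (integrable_bounded_mul _ _ Mc iy) => //.
  by apply: (measurableT_comp mc); exact: measurable_funD.
- by move=> x t _ _; have [] := db t x.
- by move=> t; rewrite mulr_ge0 //; apply: le_trans (hMd 0).
- have := integrableZl measurableT Md (integrable_norm iy).
  by apply: eq_integrable => // t _ /=; rewrite -EFinM mulrC.
- by move=> x t _ _; rewrite hd normrM ler_wpM2l.
Unshelve. all: by end_near. Qed.

Lemma weak_of_strong : strong_solution gamma f u0 S u ->
  weak_solution gamma S (Gamma (1 - gamma))^-1 y F.
Proof.
move=> [_ _ [h [ih hw hf]]] p q qS.
have cb := bump_in_class p q.
have cb' := bump_class_derive1 _ _ _ cb.
have mc := bump_class_measurable _ _ _ cb.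
have := hw _ (bump_test p q S qS).
have -> : caputo gamma u u0 (bump p q) =
    - ((Gamma (1 - gamma))^-1 * \int[mu]_s (k s * \int[mu]_t (y t * derive1 (bump p q) (t + s)))).
  rewrite /caputo /distr_conv /g_neg /distr_deriv /distr_of_fun mulrN.
  congr (- (_ * _)); apply: eq_Rintegral => s _.
  have [s0|s0|->] := ltgtP s 0.
  - by rewrite /heaviside leNgt s0 !mul0r ker_le0 ?mul0r // ltW.
  - rewrite derive1_pairing // /heaviside (ltW s0) mul1r.
    have [sS|Ss] := ltP s S; first by rewrite ker_in.
    rewrite [X in _ * X = _]Rintegral_eq0 ?mulr0; last first.
      move=> t; rewrite /window; case: ifPn => [/andP[t0 tS]|_]; last by rewrite mul0r.
      rewrite (bump_class_out _ _ _ cb' (t + s)) ?mulr0 //.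
      by rewrite negb_and -!leNgt; apply/orP; right; lra.
    by rewrite /ker [s < S]ltNge Ss andbF mul0r.
  - rewrite ker_le0 // mul0r powR0 ?mulr0 ?mul0r // oppr_eq0 gt_eqF //.
    by case/andP: g01.
move=> ->.
transitivity (\int[mu]_(t in `]0, S[) (F t * bump p q t)).
  congr fine; apply: ae_eq_integral => //.
  - apply/measurable_EFinP; apply: measurable_funM; last exact: measurable_funTS.
    by move: ih => /integrableP[/measurable_EFinP].
  - by apply/measurable_EFinP; apply: measurable_funTS; exact: measurable_funM.
  - apply: (ae_lebesgue_imply _ _ _ hf) => t ht /=; rewrite in_itv/= => tS.
    rewrite ht // /window ifT //.
    by move/andP: tS => [/ltW -> /ltW ->].
rewrite Rintegral_mkcond; apply: (Rintegral_eq_except 0).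
- by apply/(measurable_restrictT _ _).1 => //; apply: measurable_funTS; exact: measurable_funM.
- exact: measurable_funM.
- move=> t t0; rewrite patchE; case: ifPn => //; rewrite notin_setE /= in_itv/= => tS.
  have [tS'|] := boolP (0 <= t <= S); last by move=> /window_out ->; rewrite mul0r.
  rewrite (bump_class_out _ _ _ cb t) ?mulr0 //; apply/negP => /andP[_ tq].
  apply: tS; move/andP: tS' => [t1 t2]; rewrite lt_neqAle eq_sym t0 t1 /=; lra.
Qed.
End weak_of_strong.

Lemma ler_norm_between {R : realType} (a b z : R) : a <= z <= b -> `|z| <= `|a| + `|b|.
Proof.
move=> /andP[az zb]; rewrite ler_norml.
have := ler_norm b; have := ler_norm (- a); rewrite normrN.
have := normr_ge0 a; have := normr_ge0 b => h1 h2 h3 h4.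
by apply/andP; split; lra.
Qed.

(** * Continuous functions cut off to a compact interval *)

Section cutoff.
Context {R : realType}.
Local Notation mu := (@lebesgue_measure R).
Variables (S : R).
Hypothesis (S0 : 0 < S).

Lemma window_in (w : R -> R) (t : R) : 0 <= t <= S -> window S w t = w t.
Proof. by rewrite /window => ->. Qed.

Lemma measurable_window (w : R -> R) : {within `[0, S], continuous w} ->
  measurable_fun setT (window S w).
Proof.
move=> cw; have -> : window S w = w \_ `[0, S].
  apply/funext => t; rewrite patchE; have [tS|tS] := boolP (0 <= t <= S).
    by rewrite window_in // mem_set //= in_itv.
  by rewrite window_out // memNset //= in_itv; exact/negP.
apply/(measurable_restrictT _ _).1 => //.
exact: subspace_continuous_measurable_fun.
Qed.

Lemma window_bounded (w : R -> R) : {within `[0, S], continuous w} ->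
  exists M : R, forall t : R, `|window S w t| <= M.
Proof.
move=> cw.
have [c1 c1S h1] := EVT_max (ltW S0) cw.
have [c2 c2S h2] := EVT_min (ltW S0) cw.
exists (`|w c2| + `|w c1|) => t.
have [tS|tS] := boolP (0 <= t <= S); last by rewrite window_out // normr0 addr_ge0.
have tI : t \in `[0, S] by rewrite in_itv.
by rewrite window_in // ler_norm_between // h1 // h2.
Qed.

(** Taking the maximum with 0 replaces the jump of the cut-off at 0 by a constant
    extension. *)
Lemma continuous_window_max (w : R -> R) : {within `[0, S], continuous w} ->
  forall x : R, x < S -> {for x, continuous (fun z : R => window S w (Num.max z 0))}.
Proof.
move=> /(continuous_within_itvP _ S0)[coo c0 cS] x xS.
have vneg (z : R) : z <= 0 -> window S w (Num.max z 0) = w 0.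
  by move=> z0; rewrite max_r // window_in // lexx ltW.
have vpos (z : R) : 0 <= z -> z < S -> window S w (Num.max z 0) = w z.
  by move=> z0 zS; rewrite max_l // window_in // z0 ltW.
have [x0|x0|->] := ltgtP x 0.
- have nz : \near x, cst (w 0) x = window S w (Num.max x 0).
    by near=> z; rewrite vneg //; apply: ltW; near: z; exact: lt_nbhsl.
  apply: (cvg_trans (near_eq_cvg nz)).
  by rewrite vneg ?(ltW x0) //; exact: cvg_cst.
- have nz : \near x, w x = window S w (Num.max x 0).
    near=> z; rewrite vpos //; first by apply: ltW; near: z; exact: lt_nbhsr.
    by near: z; exact: lt_nbhsl.
  apply: (cvg_trans (near_eq_cvg nz)).
  by rewrite vpos ?(ltW x0) //; apply: coo; rewrite in_itv/= x0.
- apply/left_right_continuousP; rewrite vneg //; split.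
  + have nz : \forall z \near 0^'-, cst (w 0) z = window S w (Num.max z 0).
      by near=> z; rewrite vneg //; near: z; exact: nbhs_left_le.
    by apply: (cvg_trans (near_eq_cvg nz)); exact: cvg_cst.
  + have nz : \forall z \near 0^'+, w z = window S w (Num.max z 0).
      near=> z; have z0 : 0 < z by near: z; exact: nbhs_right_gt.
      have zS : z < S by near: z; exact: nbhs_right_lt.
      by rewrite vpos // ltW.
    exact: (cvg_trans (near_eq_cvg nz)).
Unshelve. all: by end_near. Qed.

Lemma within_continuous_comp (f u : R -> R) : {within `[0, S], continuous u} ->
  (forall t, 0 <= t <= S -> {for u t, continuous f}) ->
  {within `[0, S], continuous (fun t => f (u t))}.
Proof.
move=> /(continuous_within_itvP _ S0)[coo c0 cS] cf.
apply/(continuous_within_itvP _ S0); split.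
- move=> t tS; apply: (@continuous_comp _ _ _ u f); first exact: coo.
  by apply: cf; move: tS; rewrite in_itv/= => /andP[/ltW-> /ltW->].
- by apply: (cvg_comp _ _ c0); apply: cf; rewrite lexx ltW.
- by apply: (cvg_comp _ _ cS); apply: cf; rewrite lexx ltW.
Qed.

(** The values of u on [0, S] fill a compact subinterval of (alpha, beta), on which the
    derivative of f is bounded. *)
Lemma lipschitz_comp (alpha beta : \bar R) (f u : R -> R) :
  C1_on (open_itv alpha beta) f -> {within `[0, S], continuous u} ->
  (forall t : R, 0 <= t <= S -> open_itv alpha beta (u t)) ->
  exists2 L : R, 0 <= L & forall s t : R, 0 <= s <= S -> 0 <= t <= S ->
    `|f (u s) - f (u t)| <= L * `|u s - u t|.
Proof.
move=> [df cf'] cu uab.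
have [c1 c1S h1] := EVT_max (ltW S0) cu.
have [c2 c2S h2] := EVT_min (ltW S0) cu.
have rng z : z \in `[(u c2), (u c1)] -> open_itv alpha beta z.
  rewrite in_itv/= => /andP[z1 z2]; rewrite in_itv/= in c1S c2S.
  have /andP[a1 _] := uab _ c2S; have /andP[_ b1] := uab _ c1S.
  by rewrite /open_itv /= (lt_le_trans a1) ?lee_fin //= (le_lt_trans _ b1) // lee_fin.
have c12 : u c2 <= u c1 by apply: h1.
have cfw : {within `[(u c2), (u c1)], continuous (derive1 f)}.
  by apply: continuous_in_subspaceT => z /set_mem /rng; exact: cf'.
have [e1 _ k1] := EVT_max c12 cfw.
have [e2 _ k2] := EVT_min c12 cfw.
pose L := `|derive1 f e2| + `|derive1 f e1|.
have L0 : 0 <= L by rewrite addr_ge0.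
have fL z : z \in `[(u c2), (u c1)] -> `|derive1 f z| <= L.
  by move=> zI; rewrite ler_norm_between // k1 // k2.
have lip a b : a \in `[(u c2), (u c1)] -> b \in `[(u c2), (u c1)] -> a < b ->
    `|f b - f a| <= L * `|b - a|.
  move=> aI bI ab.
  have sub z : z \in `[a, b] -> z \in `[(u c2), (u c1)].
    move: aI bI; rewrite !in_itv/= => /andP[a1 a2] /andP[b1 b2] /andP[z1 z2].
    by apply/andP; split; lra.
  have dfab (z : R) : z \in `]a, b[ -> is_derive z 1 f (derive1 f z).
    move=> /subset_itv_oo_cc zI; apply: DeriveDef; last by rewrite derive1E.
    exact/df/rng/sub.
  have cfab : {within `[a, b], continuous f}.
    apply: derivable_within_continuous => z zI.
    exact/df/rng/sub.
  have [c cab ->] := MVT ab dfab cfab.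
  by rewrite normrM ler_wpM2r // fL // sub // subset_itv_oo_cc.
exists L => // s t sS tS.
have inI z : 0 <= z <= S -> u z \in `[(u c2), (u c1)].
  by move=> zS; rewrite in_itv/=; apply/andP; split; [apply: h2|apply: h1]; rewrite in_itv.
have [st|st|->] := ltgtP (u s) (u t).
- by rewrite distrC [X in _ * X]distrC; apply: lip => //; exact: inI.
- by apply: lip => //; exact: inI.
- by rewrite !subrr normr0 mulr0.
Qed.
End cutoff.

(** * The Volterra equation *)

Section volterra.
Context {R : realType}.
Local Notation mu := (@lebesgue_measure R).

Lemma initial_value (S u0 : R) (u : R -> R) : 0 < S -> {within `[0, S], continuous u} ->
  right_limit u u0 -> u 0 = u0.
Proof.
move=> S0 cu rl; have /(continuous_within_itvP _ S0)[coo c0 _] := cu.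
apply: (right_limit_value u u0 (u 0) S S0 _ c0 rl).
apply: open_continuous_measurable_fun => // t /set_mem; exact: coo.
Qed.

(** C is Gamma(1 - gamma) divided by the beta integral of the two kernels; what matters
    about it is its sign. *)
Lemma strong_solution_volterra (gamma S u0 : R) (f u : R -> R) :
  0 < gamma < 1 -> 0 < S -> {within `[0, S], continuous u} ->
  (forall t : R, 0 <= t <= S -> {for u t, continuous f}) ->
  strong_solution gamma f u0 S u ->
  exists2 C : R, 0 < C & forall x : R, 0 < x < S ->
    u x - u0 = C * conv (ker (gamma - 1) S) (window S (fun t => f (u t))) x.
Proof.
move=> g01 S0 cu cf sol; have /andP[gam0 gam1] := g01.
have [_ rl _] := sol.
have u00 := initial_value S u0 u S0 cu rl.
have cy : {within `[0, S], continuous (fun t => u t - u0)}.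
  apply: (within_continuous_comp S S0 (fun z => z - u0) u cu) => t _.
  by apply: cvgB; [exact: cvg_id|exact: cvg_cst].
have cF := within_continuous_comp S S0 f u cu cf.
pose y := window S (fun t => u t - u0).
pose F := window S (fun t => f (u t)).
have my : measurable_fun setT y := measurable_window S _ cy.
have mF : measurable_fun setT F := measurable_window S _ cF.
have [M1 hy] := window_bounded S S0 _ cy.
have [M2 hF] := window_bounded S S0 _ cF.
have yM (x : R) : `|y x| <= Num.max M1 M2 by rewrite le_max hy.
have FM (x : R) : `|F x| <= Num.max M1 M2 by rewrite le_max hF orbT.
have weak := weak_of_strong gamma S u0 f u g01 _ my mF yM sol.
have b0 := @beta_gamma_gt0 R gamma g01.
have G0 : 0 < (Gamma (1 - gamma))^-1 by rewrite invr_gt0; apply: Gamma_gt0; lra.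
set G := _^-1 in weak G0.
have ort := weak_bump_orthogonal gamma S g01 S0 G _ y F weak my mF yM FM
  (window_out S _) (window_out S _).
have GB0 : 0 < G * beta (gamma - 1) (- gamma) by rewrite mulr_gt0.
set GB := G * _ in ort GB0.
exists GB^-1; first by rewrite invr_gt0.
move=> x xS; have /andP[x0 xS'] := xS.
have ig := @integrable_abel_kernel _ gamma S g01.
have yx : y x = u x - u0 by rewrite /y window_in // !ltW.
have cFx : {for x, continuous (conv (ker (gamma - 1) S) F)}.
  apply: (continuous_conv_ker_jump gamma S g01 S0 F _ mF FM _ _ x xS).
    by move=> z z0; apply: window_out; rewrite negb_and -ltNge z0.
  exact: continuous_window_max.
have cyx : {for x, continuous (fun z => GB * y z)}.
  apply: cvgMl_tmp.
  have nz : \near x, u x - u0 = y x.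
    near=> z; rewrite /y window_in //; apply/andP; split; apply: ltW; near: z.
      exact: lt_nbhsr.
    exact: lt_nbhsl.
  rewrite yx; apply: (cvg_trans (near_eq_cvg nz)).
  have /(continuous_within_itvP _ S0)[coo _ _] := cy.
  by apply: coo; rewrite in_itv.
have mGy : measurable_fun setT (fun z => GB * y z) by exact: measurable_funM.
have mcF : measurable_fun setT (conv (ker (gamma - 1) S) F) := measurable_conv _ _ _ ig mF FM.
pose M := `|GB| * Num.max M1 M2 + (\int[mu]_t `|ker (gamma - 1) S t|) * Num.max M1 M2.
have M0 : 0 <= Num.max M1 M2 := le_trans (normr_ge0 _) (yM 0).
have h1 (z : R) : `|GB * y z| <= M.
  rewrite normrM -[leLHS]addr0; apply: lerD; first exact: ler_wpM2l.
  by rewrite mulr_ge0 // Rintegral_ge0.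
have h2 (z : R) : `|conv (ker (gamma - 1) S) F z| <= M.
  rewrite -[leLHS]add0r; apply: lerD; first by rewrite mulr_ge0.
  exact: conv_bounded.
have le1 := continuous_orthogonal_bump S _ _ M mGy mcF h1 h2 ort x xS cyx cFx.
have le2 := continuous_orthogonal_bump S _ _ M mcF mGy h2 h1 (fun p q qS => esym (ort p q qS)) x xS cFx cyx.
have e : GB * y x = conv (ker (gamma - 1) S) F x by apply/eqP; rewrite eq_le le1 le2.
by rewrite -yx -e mulKf // gt_eqF.
Unshelve. all: by end_near. Qed.
End volterra.

(** * Monotonicity according to the sign of f u0 *)

Section sign.
Context {R : realType}.

(** If f u0 < 0, the functions -y and -F satisfy the hypotheses of the increasing
    case. *)
Lemma solution_sign (gamma : R) (alpha beta : \bar R) (f : R -> R) (u0 S : R) (u : R -> R) :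
  0 < gamma < 1 -> C1_on (open_itv alpha beta) f -> 0 < S ->
  {within `[0, S], continuous u} ->
  (forall t : R, 0 <= t <= S -> open_itv alpha beta (u t)) ->
  strong_solution gamma f u0 S u ->
  [/\ f u0 = 0 -> forall t, 0 <= t < S -> u t = u0,
      0 < f u0 -> forall s t, 0 <= s -> s < t -> t < S -> u s < u t &
      f u0 < 0 -> forall s t, 0 <= s -> s < t -> t < S -> u t < u s].
Proof.
move=> g01 C1 S0 cu uab sol.
have cf (t : R) : 0 <= t <= S -> {for u t, continuous f}.
  move=> tS; apply/differentiable_continuous/derivable1_diffP.
  by have [df _] := C1; exact/df/uab.
have [L L0 lip] := lipschitz_comp S S0 alpha beta f u C1 cu uab.
have [C C0 yE] := strong_solution_volterra gamma S u0 f u g01 S0 cu cf sol.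
have [_ rl _] := sol.
have u00 := initial_value S u0 u S0 cu rl.
have S00 : 0 <= (0 : R) <= S by rewrite lexx ltW.
have cy : {within `[0, S], continuous (fun t => u t - u0)}.
  apply: (within_continuous_comp S S0 (fun z => z - u0) u cu) => t _.
  by apply: cvgB; [exact: cvg_id|exact: cvg_cst].
have cF := within_continuous_comp S S0 f u cu cf.
pose y := window S (fun t => u t - u0).
pose F := window S (fun t => f (u t)).
have mF : measurable_fun setT F := measurable_window S _ cF.
have [M FM] := window_bounded S S0 _ cF.
have F0 (x : R) : x < 0 -> F x = 0.
  by move=> x0; apply: window_out; rewrite negb_and -ltNge x0.
have y0 (x : R) : x <= 0 -> y x = 0.
  rewrite le_eqVlt => /orP[/eqP->|x0]; first by rewrite /y window_in // u00 subrr.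
  by apply: window_out; rewrite negb_and -ltNge x0.
have inS (x : R) : 0 <= x < S -> 0 <= x <= S by move=> /andP[-> /ltW].
have yI (x : R) : 0 <= x < S -> y x = u x - u0 by move=> /inS xS; rewrite /y window_in.
have FI (x : R) : 0 <= x < S -> F x = f (u x) by move=> /inS xS; rewrite /F window_in.
have yE' (x : R) : 0 < x < S -> y x = C * conv (ker (gamma - 1) S) F x.
  by move=> xS; rewrite -yE // yI //; move: xS => /andP[/ltW-> ->].
have lipF (s t : R) : 0 <= s < S -> 0 <= t < S -> `|F s - F t| <= L * `|y s - y t|.
  move=> sS tS; rewrite !FI // !yI // opprB addrA subrK.
  by apply: lip; exact: inS.
have ycont (x : R) : x < S -> {for x, continuous y}.
  move=> xS; have := continuous_window_max S S0 _ cy x xS.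
  suff -> : (fun z : R => window S (fun t => u t - u0) (Num.max z 0)) = y by [].
  apply/funext => z; have [z0|z0] := leP z 0.
    by rewrite -/y !y0.
  by [].
have Fcont := continuous_window_max S S0 _ cF.
have F00 : F 0 = f u0 by rewrite FI ?u00 // lexx.
have lower (sg : R) : 0 < sg * f u0 -> exists2 h : R, 0 < h < S &
    forall x, 0 <= x <= h -> sg * f u0 / 2 <= sg * F x.
  move=> sf.
  have cs : {for 0, continuous (fun z : R => sg * F (Num.max z 0))}.
    by apply: cvgMl_tmp; exact: Fcont.
  have hf : sg * f u0 / 2 < sg * F (Num.max 0 0) by rewrite maxxx F00; lra.
  have /cvgr_ge := cs => /(_ _ hf) [e /= e0 he].
  pose h := Num.min (e / 2) (S / 2).
  have h0 : 0 < h by rewrite lt_min !divr_gt0.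
  have [h1 h2] : h <= e / 2 /\ h <= S / 2 by rewrite /h !ge_min !lexx orbT.
  exists h; first by rewrite h0 /=; lra.
  move=> x /andP[x0 xh].
  have := he x; rewrite max_l //; apply.
  by rewrite /ball_ /= sub0r normrN ger0_norm //; lra.
split.
- move=> f0 t tS; apply/eqP; rewrite -subr_eq0 -yI //; apply/eqP.
  apply: (@zero_of_volterra _ gamma S g01 y F C L M) => //; last by case/andP: tS.
  move=> s sS; have := lipF s 0 sS; rewrite F00 f0 (y0 0 (lexx 0)) !subr0; apply.
  by rewrite lexx.
- move=> f0 s t s0 st tS.
  have sf : 0 < 1 * f u0 by rewrite mul1r.
  have [h /andP[h0 hS] hh] := lower 1 sf.
  have m0 : 0 < f u0 / 2 by rewrite divr_gt0.
  have := @strictly_increasing_of_pos _ gamma S g01 S0 y F C L M (f u0 / 2) h C0 L0 mF FM F0 y0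
    yE' ycont lipF m0 h0 hS.
  move=> /(_ _ s t s0 st tS); rewrite !yI ?ltrD2r; [|by apply/andP; split; lra..].
  by apply => x xh; have := hh x xh; rewrite !mul1r.
- move=> f0 s t s0 st tS.
  have sf : 0 < -1 * f u0 by rewrite mulN1r oppr_gt0.
  have [h /andP[h0 hS] hh] := lower (-1) sf.
  have m0 : 0 < - f u0 / 2 by rewrite divr_gt0 // oppr_gt0.
  have := @strictly_increasing_of_pos _ gamma S g01 S0 (\- y) (\- F) C L M (- f u0 / 2) h C0 L0
    (measurable_funN mF).
  move=> /(_ _ _ _ _ _ _ m0 h0 hS _ s t s0 st tS).
  rewrite /= ltrN2 !yI ?ltrD2r; [|by apply/andP; split; lra..].
  apply.
  + by move=> x; rewrite normrN.
  + by move=> x x0; rewrite F0 // oppr0.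
  + by move=> x x0; rewrite y0 // oppr0.
  + move=> x xS; rewrite yE' // -mulrN; congr (_ * _).
    rewrite -mulN1r /conv -RintegralZl_measurable; last first.
      apply: measurable_funM; first exact: measurable_ker.
      by apply: (measurableT_comp mF); exact: measurable_funB.
    by apply: eq_Rintegral => z _; rewrite mulN1r mulrN.
  + by move=> x xS; apply: cvgN; exact: ycont.
  + by move=> a b aS bS; rewrite -!opprD !normrN; exact: lipF.
  + by move=> x xh; have := hh x xh; rewrite !mulN1r.
Qed.

Lemma exists_between (t : R) (Tb : \bar R) : (t%:E < Tb)%E ->
  exists2 S : R, t < S & (S%:E < Tb)%E.
Proof.
case: Tb => [b||] // tb; last by exists (t + 1); rewrite ?ltrDl ?ltry.
by exists ((t + b) / 2); rewrite ?lte_fin; rewrite lte_fin in tb; lra.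
Qed.
End sign.

Theorem theorem3p4 (R : realType) (gamma : R) (alpha beta : \bar R)
    (f : R -> R) (u0 : R) (Tb : \bar R) (u : R -> R) :
  0 < gamma < 1 ->
  C1_on (open_itv alpha beta) f ->
  locally_lipschitz_on (open_itv alpha beta) (derive1 f) ->
  open_itv alpha beta u0 ->
  maximal_solution gamma alpha beta f u0 Tb u ->
  monotone_on (open_itv 0%E Tb) u /\
  (f u0 != 0 -> strictly_monotone_on (open_itv 0%E Tb) u).
Proof.
move=> g01 C1 _ _ [Tb0 [cu uab sol] _].
have sign S : 0 < S -> (S%:E < Tb)%E ->
  [/\ f u0 = 0 -> forall t, 0 <= t < S -> u t = u0,
      0 < f u0 -> forall s t, 0 <= s -> s < t -> t < S -> u s < u t &
      f u0 < 0 -> forall s t, 0 <= s -> s < t -> t < S -> u t < u s].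
  move=> S0 STb.
  have sub (t : R) : 0 <= t <= S -> time_itv Tb t.
    move=> /andP[t0 tS]; rewrite /time_itv /= lee_fin t0 /=.
    by apply: le_lt_trans STb; rewrite lee_fin.
  apply: (solution_sign gamma alpha beta) => //.
  - by apply: continuous_subspaceW cu => t /=; rewrite in_itv/=; exact: sub.
  - by move=> t /sub; exact: uab.
  - exact: sol.
have range (t : R) : open_itv 0%E Tb t -> exists S : R, [/\ 0 < t, t < S & (S%:E < Tb)%E].
  move=> /andP[t0 /exists_between[S tS STb]]; exists S; split => //.
have strict : f u0 != 0 -> strictly_monotone_on (open_itv 0%E Tb) u.
  rewrite neq_lt => /orP[f0|f0]; [right|left]; move=> s t /set_mem/range[_ [s0 _ _]]
      /set_mem/range[S [t0 tS STb]] st.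
  - by have [_ _] := sign S (lt_trans t0 tS) STb; apply => //; exact: ltW.
  - by have [_ + _] := sign S (lt_trans t0 tS) STb; apply => //; exact: ltW.
split=> //; have [f0|f0] := eqVneq (f u0) 0.
  left=> s t /set_mem/range[S1 [s0 sS1 S1b]] /set_mem/range[S2 [t0 tS2 S2b]] _.
  have [h1 _ _] := sign S1 (lt_trans s0 sS1) S1b.
  have [h2 _ _] := sign S2 (lt_trans t0 tS2) S2b.
  by rewrite h1 ?h2 ?(ltW s0) ?(ltW t0).
have [h|h] := strict f0; [left|right] => s t sA tA; rewrite le_eqVlt => /orP[/eqP->//|st]; apply: ltW.
  exact: h.
exact: h.
Qed.
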